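(* Let $G$ and $H$ be finite abelian groups and let $e$ be the exponent of $G$. Let $F$ be a field of characteristic $0$ such that: for every odd prime $p$ dividing $e$, either $\zeta_p\in F$ or $F\cap\mathbb{Q}(\zeta_{p^2})\subseteq\mathbb{Q}(\zeta_p)$; and if $2\mid e$, either $\zeta_4\in F$ or $F\cap\mathbb{Q}(\zeta_8)=\mathbb{Q}$. Then $G\sim_F H$ implies $G\cong H$.
   Context: For a positive integer $n$, $\zeta_n$ is a primitive $n$-th root of unity; fix an algebraic closure $\bar F$ of $F$ containing the algebraic closure $\bar{\mathbb{Q}}$ of $\mathbb{Q}$, take $\zeta_n\in\bar F$, and form intersections inside $\bar F$. Twisted group rings and $\sim_R$: for a commutative ring $R$ and a finite group $G$, $H^2(G,R^* )$ is the second cohomology group with trivial action on $R^*$; for $\alpha\in Z^2(G,R^* )$ the twisted group ring $R^\alpha G$ is the free $R$-module with basis $\{u_g\}_{g\in G}$, $R$ central, $u_gu_h=\alpha(g,h)u_{gh}$. $G\sim_R H$ means there is a group isomorphism $\psi:H^2(G,R^* )\to H^2(H,R^* )$ with $R^\alpha G\cong R^{\psi(\alpha)}H$ as rings for all $[\alpha]\in H^2(G,R^* )$. *)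

(* Defs.v *)
From HB Require Import structures.
From mathcomp Require Import all_boot all_order all_algebra all_fingroup all_solvable all_field.
Set Implicit Arguments. Unset Strict Implicit. Unset Printing Implicit Defensive.
Import Order.TTheory GRing.Theory Num.Theory.
Local Open Scope ring_scope.

Section Twisted.
Variables (R : comUnitRingType) (gT : finGroupType).

Definition cocycle (alpha : gT -> gT -> R) : Prop :=
  (forall g h, alpha g h \is a GRing.unit) /\
  (forall g h k, alpha h k * alpha g (h * k)%g = alpha g h * alpha (g * h)%g k).

Definition cohom (alpha alpha' : gT -> gT -> R) : Prop :=
  exists (beta : gT -> R), (forall g, beta g \is a GRing.unit) /\
    forall g h, alpha' g h = alpha g h * (beta g * beta h / beta (g * h)%g).

Definition comul (alpha alpha' : gT -> gT -> R) : gT -> gT -> R :=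
  fun g h => alpha g h * alpha' g h.

(* The twisted group ring R^alpha G, with underlying R-module {ffun gT -> R}
   (coefficient of u_g at g), and multiplication determined by
   u_g u_h = alpha(g,h) u_{gh}. *)
Definition tmul (alpha : gT -> gT -> R) (a b : {ffun gT -> R}) : {ffun gT -> R} :=
  [ffun x => \sum_(g : gT) \sum_(h : gT | (g * h)%g == x) a g * b h * alpha g h].

Definition tone (alpha : gT -> gT -> R) : {ffun gT -> R} :=
  [ffun x => if x == 1%g then (alpha 1%g 1%g)^-1 else 0].

End Twisted.

Definition twisted_ring_iso (R : comUnitRingType) (gT hT : finGroupType)
  (alpha : gT -> gT -> R) (beta : hT -> hT -> R) : Prop :=
  exists (phi : {ffun gT -> R} -> {ffun hT -> R}),
    bijective phi /\
    (forall a b, phi (a + b) = phi a + phi b) /\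
    (forall a b, phi (tmul alpha a b) = tmul beta (phi a) (phi b)) /\
    phi (tone alpha) = tone beta.

(* G ~_R H : a group isomorphism psi : H^2(G,R^x) -> H^2(H,R^x) with
   R^alpha G ~= R^psi(alpha) H for all classes.  psi is represented by a map
   on cocycles that is well defined, multiplicative, injective and surjective
   on cohomology classes. *)
Definition sim_ring (R : comUnitRingType) (gT hT : finGroupType) : Prop :=
  exists (psi : (gT -> gT -> R) -> (hT -> hT -> R)),
    (forall alpha, cocycle alpha -> cocycle (psi alpha)) /\
    [/\
        forall alpha alpha', cocycle alpha -> cocycle alpha' ->
          cohom alpha alpha' -> cohom (psi alpha) (psi alpha'),
        forall alpha alpha', cocycle alpha -> cocycle alpha' ->
          cohom (psi (comul alpha alpha')) (comul (psi alpha) (psi alpha')),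
        forall alpha alpha', cocycle alpha -> cocycle alpha' ->
          cohom (psi alpha) (psi alpha') -> cohom alpha alpha',
        forall beta, cocycle beta -> exists2 alpha, cocycle alpha & cohom (psi alpha) beta
      & forall alpha, cocycle alpha -> twisted_ring_iso alpha (psi alpha)].

Definition in_Qadj (L : fieldType) (z x : L) : Prop :=
  exists q : {poly rat}, x = (map_poly (@ratr L) q).[z].

(* Main.v *)
Require Import Defs.
From HB Require Import structures.
From mathcomp Require Import all_boot all_order all_algebra all_fingroup all_solvable all_field.
From mathcomp Require Import boolp ring.
Import Order.TTheory GRing.Theory Num.Theory.
Set Implicit Arguments. Unset Strict Implicit. Unset Printing Implicit Defensive.
Local Open Scope ring_scope.

(* Write G as a product of cyclic groups of orders d_0, d_1, ... with d_j | d_i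
   for i <= j, and let v_i be the p-adic valuation of d_i.

   The trivial class gives a ring isomorphism FG ~ FH.  It need not be F-linear,
   but it matches the kernels of the characters gT -> L, and matched characters
   generate the same subfield of L (both fields contain roots of unity of the
   same orders).  Hence G and H have equally many characters with values in any
   field M between F and L.  If M = F(zeta_(p^m)) does not contain
   zeta_(p^(m+1)), the p-part of this number is p ^ (sum_i min(m, v_i)).

   Symmetric cocycles are those with a commutative twisted ring, so the
   isomorphism of cohomology groups induces one between the groups of
   commutator forms g, h |-> alpha g h / alpha h g.  If zeta_(p^t) is in F, the
   forms killed by p^t number p ^ (sum_j j * min(t, v_j)).

   The hypotheses on F provide some k such that zeta_(p^k) is in F and
   F(zeta_(p^m)) has no zeta_(p^(m+1)) for m >= k (m > 0), so the second count
   applies for t <= k and the first for m >= k; together they determine the v_i. *)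

(** * Roots of unity in cyclotomic extensions *)

(** The first count is blind below level [k]: a character of [p]-power order at most [p ^ k] takes
    its values in F, whatever the group. Commutator forms see just these levels, because their
    values are roots of unity of F itself. If [zeta_p] were missing from F while F(zeta_p) contained
    zeta_(p^2), level 1 would escape both counts; the hypotheses on F rule out such gaps. A ring
    isomorphism may move the scalars, so it transports only kernels and relations with integer
    coefficients, such as [u ^ n = 1]. Roots of unity are determined up to conjugacy by relations of
    this kind, which is why the fields of values can still be compared. *)

Definition in_adj (F L : fieldType) (f : F -> L) (z x : L) : Prop :=
  exists q : {poly F}, x = (map_poly f q).[z].

Lemma det_expr (R : comNzRingType) n (A : 'M[R]_n.+1) m : \det (A ^+ m) = \det A ^+ m.
Proof. by elim: m => [|m IHm]; rewrite ?expr0 ?det1 // !exprS detM IHm. Qed.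

Lemma exists_companion (F : fieldType) (p : {poly F}) n :
  p \is monic -> size p = n.+2 -> exists C : 'M[F]_n.+1, char_poly C = p.
Proof.
move=> mon_p sz_p; have e : (size p).-1 = n.+1 by rewrite sz_p.
move: (companionmx p) (companionmxK mon_p); rewrite e => C defp.
by exists C.
Qed.

Lemma horner_mx_dvd (F : fieldType) n (C : 'M[F]_n.+1) (q : {poly F}) :
  char_poly C %| q -> horner_mx C q = 0.
Proof. by move/dvdpP=> [r ->]; rewrite rmorphM /= Cayley_Hamilton mulr0. Qed.

(** A norm argument: the companion matrix [C] of a proper factor of degree D satisfies [C ^ p = a],
    so [det C] has p-th power [a ^ D], and D is prime to p. Hence ['X^p - a] is irreducible as soon
    as it has no root. *)
Lemma exists_pth_root (F : fieldType) (p : nat) (a : F) (g : {poly F}) :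
  prime p -> g %| 'X^p - a%:P -> (1 < size g <= p)%N -> exists x, x ^+ p = a.
Proof.
move=> p_pr dvd_g /andP[g_gt1 g_lep].
have p_gt0 := prime_gt0 p_pr.
have [->|a_neq0] := eqVneq a 0; first by exists 0; rewrite expr0n gtn_eqF.
have g_neq0 : g != 0 by rewrite -size_poly_gt0 ltnW.
pose g1 := (lead_coef g)^-1 *: g.
have c_neq0 : (lead_coef g)^-1 != 0 by rewrite invr_eq0 lead_coef_eq0.
have mon_g1 : g1 \is monic by rewrite monicE lead_coefZ mulVf ?lead_coef_eq0.
have sz_g1 : size g1 = (size g).-2.+2.
  by rewrite size_scale //; case: (size g) g_gt1 => [|[|n]].
have [C charC] := exists_companion mon_g1 sz_g1.
have Cp : C ^+ p = a%:M.
  have : horner_mx C ('X^p - a%:P) = 0.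
    by apply: horner_mx_dvd; rewrite charC dvdpZl.
  by rewrite rmorphB rmorphXn /= horner_mx_X horner_mx_C => /eqP; rewrite subr_eq0 => /eqP.
have detC : (\det C) ^+ p = a ^+ (size g).-1.
  by rewrite -det_expr Cp det_scalar; case: (size g) g_gt1 => [|[|n]].
have D_gt0 : (0 < (size g).-1)%N by case: (size g) g_gt1 => [|[|n]].
have co : coprime p (size g).-1.
  rewrite prime_coprime // gtnNdvd // (leq_trans _ g_lep) // prednK //.
  exact: ltnW.
have [u v uv _] := egcdnP p D_gt0.
move: co; rewrite coprime_sym => /eqP co; rewrite co in uv.
(* Bezout: [u * D = v * p + 1] for the degree D of [g], so this quotient has p-th power
   [a ^ (D * u - v * p) = a]. *)
exists ((\det C) ^+ u / a ^+ v).
rewrite exprMn exprAC detC exprVn -!exprM mulnC uv exprD mulrAC divff ?mul1r //.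
by rewrite expf_neq0.
Qed.

Lemma prim_root_pth_root (F : fieldType) (p m : nat) (x : F) :
  prime p -> (p ^ m.+1).-primitive_root (x ^+ p) -> (p ^ m.+2).-primitive_root x.
Proof.
move=> p_pr prx.
have x1 : x ^+ (p ^ m.+2) = 1 by rewrite expnS exprM (prim_expr_order prx).
have p_gt0 := prime_gt0 p_pr.
have pn_gt0 : (0 < p ^ m.+2)%N by rewrite expn_gt0 p_gt0.
have [n prn] := prim_order_exists pn_gt0 x1.
case/(dvdn_pfactor _ _ p_pr)=> j j_le defn; rewrite defn in prn.
have [<-//|j_lt] := eqVneq j m.+2.
have {}j_lt : (j <= m.+1)%N by rewrite -ltnS ltn_neqAle j_lt.
have : (x ^+ p) ^+ (p ^ m) == 1.
  rewrite -exprM -expnS -(prim_order_dvd prn).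
  by rewrite dvdn_exp2l.
by rewrite -(prim_order_dvd prx) dvdn_Pexp2l ?prime_gt1 // ltnn.
Qed.

Lemma prim_root_pow (F : fieldType) (p m n : nat) (x : F) :
  prime p -> (p ^ (m + n)).-primitive_root x ->
  (p ^ m).-primitive_root (x ^+ (p ^ n)).
Proof.
move=> p_pr prx; have p_gt0 := prime_gt0 p_pr.
have := exp_prim_root prx (p ^ n).
by rewrite (gcdn_idPl _) ?expnD ?mulnK ?expn_gt0 ?p_gt0 ?dvdn_mull.
Qed.

Lemma root_gcdp_map (F L : fieldType) (f : {rmorphism F -> L}) (P Q : {poly F}) z :
  root (map_poly f P) z -> root (map_poly f Q) z -> root (map_poly f (gcdp P Q)) z.
Proof. by move=> rP rQ; rewrite gcdp_map root_gcd rP. Qed.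

Lemma size_root_gt1 (F L : fieldType) (f : {rmorphism F -> L}) (P : {poly F}) z :
  P != 0 -> root (map_poly f P) z -> (1 < size P)%N.
Proof.
move=> P_neq0 rP; rewrite -(size_map_poly f); apply: root_size_gt1 rP.
by rewrite map_poly_eq0.
Qed.

(** Modulo ['X^p - a] the polynomial [q] is a p-th root of ['X], so [q(C) ^ p = C] for the companion
    matrix [C], whose determinant is [(-1) ^ (p + 1) * a]. *)
Lemma det_horner_companion (F : fieldType) (p : nat) (a : F) (q : {poly F}) :
  (0 < p)%N -> 'X^p - a%:P %| q ^+ p - 'X ->
  exists x, x ^+ p = (-1) ^+ p.+1 * a.
Proof.
case: p => // p _ dvd_q.
have sz : size ('X^(p.+1) - a%:P) = p.+2 by rewrite size_XnsubC.
have [C charC] := exists_companion (monicXnsubC a (ltn0Sn p)) sz.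
have /eqP : horner_mx C (q ^+ p.+1 - 'X) = 0 by apply: horner_mx_dvd; rewrite charC.
rewrite rmorphB rmorphXn /= horner_mx_X subr_eq0 => /eqP defC.
exists (\det (horner_mx C q)).
rewrite -det_expr defC.
have := char_poly_det C; rewrite charC coefB coefXn coefC /= sub0r => defa.
by rewrite exprS mulN1r mulNr -mulrN defa signrMK.
Qed.

(* If [rho = q(rho ^+ p)], the determinant of [q] evaluated at the companion matrix of
   ['X^p - a] is the norm of [rho], and its [p]-th power is [a] up to sign. *)
Lemma in_adj_step (F L : fieldType) (f : {rmorphism F -> L}) (p m : nat) (rho : L) a :
  prime p -> (p = 2%N -> (0 < m)%N) -> (p ^ m.+3).-primitive_root rho ->
  f a = rho ^+ (p ^ 2) -> (forall x, f x != rho ^+ p) ->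
  ~ in_adj f (rho ^+ p) rho.
Proof.
move=> p_pr m_gt0 pr_rho fa notF [q def_rho].
have p_gt0 := prime_gt0 p_pr.
have pr_a : (p ^ m.+1).-primitive_root a.
  rewrite -(fmorph_primitive_root f) fa.
  by apply: prim_root_pow; rewrite // addn2.
have pr_th : (p ^ m.+2).-primitive_root (rho ^+ p).
  by rewrite -{2}(expn1 p); apply: prim_root_pow; rewrite // addn1.
(* A p-th root of [a] in F would have order [p ^ m.+2], and [rho ^+ p] would be one of its
   powers. *)
have no_root x : x ^+ p <> a.
  move=> xp; have := pr_a; rewrite -xp => /(prim_root_pth_root p_pr).
  rewrite -(fmorph_primitive_root f) => pr_x.
  have [i /eqP] := prim_rootP pr_x (prim_expr_order pr_th).
  by rewrite eq_sym -rmorphXn (negPf (notF _)).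
pose A := 'X^p - a%:P; pose P := q ^+ p - 'X; pose g := gcdp P A.
have A_neq0 : A != 0 by rewrite -size_poly_gt0 size_XnsubC.
have g_neq0 : g != 0 by rewrite gcdp_eq0 negb_and A_neq0 orbT.
have g_gt1 : (1 < size g)%N.
  apply: (size_root_gt1 (f := f) (z := rho ^+ p)) => //.
  apply: root_gcdp_map; apply/rootP.
    by rewrite rmorphB rmorphXn /= map_polyX !hornerE -def_rho subrr.
  by rewrite rmorphB /= map_polyXn map_polyC !hornerE /= fa -exprM mulnn subrr.
have dvd_gA : g %| A by apply: dvdp_gcdr.
(* Having no root, [A] is irreducible; it shares the root [rho ^+ p] with [P], so the gcd is all of
   [A]. *)
have [g_lep|g_gtp] := leqP (size g) p.
  by have [x /no_root] := exists_pth_root p_pr dvd_gA (introT andP (conj g_gt1 g_lep)).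
have dvd_AP : A %| P.
  have : g %= A.
    rewrite -(dvdp_size_eqp dvd_gA) eqn_leq (dvdp_leq A_neq0 dvd_gA).
    by rewrite size_XnsubC.
  by move/eqp_dvdl=> <-; apply: dvdp_gcdl.
have [x] := det_horner_companion p_gt0 dvd_AP.
have [p2|p_odd] := even_prime p_pr.
  (* For [p = 2] the norm gives a square root of [- a]. Since [m > 0], the power [a ^ (2 ^ (m - 1))]
     is a square root of -1 in F and absorbs the sign. *)
  rewrite p2 => xx.
  have m1 := m_gt0 p2; rewrite p2 in pr_a no_root.
  have i2 : (a ^+ (2 ^ m.-1)) ^+ 2 = -1.
    rewrite -exprM -expnSr prednK //.
    have pr2 : (2 ^ 1).-primitive_root (a ^+ (2 ^ m)) by exact: prim_root_pow.
    have := prim_expr_order pr2; rewrite expn1 => /eqP.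
    rewrite sqrf_eq1 => /orP[/eqP a1|/eqP//].
    by have := prim_order_dvd pr2 1; rewrite expr1 a1 eqxx.
  have /no_root[] : (a ^+ (2 ^ m.-1) * x) ^+ 2 = a.
  by rewrite exprMn i2 xx mulrA -exprS -signr_odd expr0 mul1r.
by rewrite -signr_odd /= p_odd mul1r => /no_root.
Qed.

(** Turns F(z) into a field of its own between F and L, so that inductions may change the base
    field. *)
Lemma exists_adjunction (F L : fieldType) (f : {rmorphism F -> L}) z (p : {poly F}) :
  p != 0 -> root (map_poly f p) z ->
  exists (K : fieldType) (i : {rmorphism F -> K}) (j : {rmorphism K -> L}),
    (forall x, j (i x) = f x) /\ (forall y, (exists x, j x = y) <-> in_adj f z y).
Proof.
move=> p_neq0 rp.
exists (subFExtend f z p), (subfx_eval f z p \o polyC : {rmorphism _ -> _}), subfx_inj.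
split=> [x|y] /=; first by rewrite subfx_inj_eval // map_polyC hornerC.
split=> [[x <-]|[q ->]].
  by have [q ->] := subfxE x; exists q; rewrite subfx_inj_eval.
by exists (subfx_eval f z p q); rewrite subfx_inj_eval.
Qed.

(** The tower is climbed one p-th root at a time: F misses the root of order [p ^ m.+1], and by
    [in_adj_step] adjoining it does not bring in the one of order [p ^ m.+2]. So the hypotheses hold
    again over the larger field, with [m.+1] for [m]. *)
Lemma in_adj_tower (F L : fieldType) (f : {rmorphism F -> L}) (p m n : nat) (Z : L) :
  prime p -> (p = 2%N -> (1 < m)%N) -> (0 < m)%N ->
  (p ^ (m + n.+1)).-primitive_root Z ->
  (exists a, f a = Z ^+ (p ^ n.+1)) -> (forall x, f x != Z ^+ (p ^ n)) ->
  ~ in_adj f (Z ^+ p) Z.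
Proof.
move=> p_pr; have p_gt0 := prime_gt0 p_pr.
elim: n F f m => [|n IHn] F f m m_gt1 m_gt0 prZ [a fa] notF.
  case=> q defZ.
  have := notF q.[a]; rewrite -horner_map fa expn1 -defZ expn0 expr1.
  by rewrite eqxx.
move=> adjZ; set th := Z ^+ (p ^ n.+1).
have n1_gt0 : (0 < p ^ n.+2)%N by rewrite expn_gt0 p_gt0.
have th_p : th ^+ p = f a by rewrite fa -exprM -expnSr.
have A_neq0 : 'X^p - a%:P != 0 by rewrite -size_poly_gt0 size_XnsubC.
have rA : root (map_poly f ('X^p - a%:P)) th.
  by apply/rootP; rewrite rmorphB /= map_polyXn map_polyC !hornerE /= th_p subrr.
have [K [i [j [ji jK]]]] := exists_adjunction A_neq0 rA.
apply: (IHn K j m.+1) => //; first by rewrite addSnnS.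
- by apply/jK; exists 'X; rewrite map_polyX hornerX.
- move=> x; apply/negP=> /eqP jx.
  case: m m_gt1 m_gt0 prZ => // m m_gt1 _ prZ.
  have Zp k l : Z ^+ (p ^ k) ^+ (p ^ l) = Z ^+ (p ^ (k + l)).
    by rewrite -exprM -expnD.
  have thE : th = (Z ^+ (p ^ n)) ^+ p by rewrite -exprM -expnSr.
  apply: (@in_adj_step _ _ f p m (Z ^+ (p ^ n)) a) => //.
  + by apply: prim_root_pow => //; rewrite addSn addnS addnS in prZ; rewrite !addSn.
  + by rewrite fa Zp addn2.
  + by move=> y; rewrite -thE; apply: notF.
  by rewrite -thE; apply/jK; exists x.
- case: adjZ => q defZ; exists (map_poly i q).
  by rewrite -map_poly_comp (eq_map_poly (g := f)).
Qed.

(** * Rational numbers and cyclotomic degrees in a field of characteristic 0 *)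

Section RationalSubfield.

Variable L : fieldType.
Hypothesis charL : [pchar L] =i pred0.

Let intr_eq0L (m : int) : (m%:~R == 0 :> L) = (m == 0).
Proof.
have nat_eq0 := (pcharf0P _).1 charL.
by case: m => n; rewrite ?NegzE ?mulrNz ?oppr_eq0 ?pmulrn nat_eq0.
Qed.

Let ratr_frac (a b : int) : b != 0 -> ratr (a%:~R / b%:~R) = a%:~R / b%:~R :> L.
Proof.
move=> b_neq0; set x : rat := _ / _.
have bL_neq0 : b%:~R != 0 :> L by rewrite intr_eq0L.
have dL_neq0 : (denq x)%:~R != 0 :> L by rewrite intr_eq0L denq_neq0.
rewrite /ratr; apply/eqP; rewrite eqr_div // -!intrM; apply/eqP; congr _%:~R.
apply/eqP; rewrite -(eqr_int rat) !intrM.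
rewrite -eqr_div ?intr_eq0 ?denq_neq0 //; apply/eqP; exact: divq_num_den.
Qed.

Lemma exists_ratr_rmorphism : exists g : {rmorphism rat -> L}, forall x, g x = ratr x.
Proof.
have den_neq0 (x : rat) : (denq x)%:~R != 0 :> rat by rewrite intr_eq0 denq_neq0.
have denL_neq0 (x : rat) : (denq x)%:~R != 0 :> L by rewrite intr_eq0L denq_neq0.
have ratrB : zmod_morphism (@ratr L).
  move=> x y; rewrite -{1}(divq_num_den x) -{1}(divq_num_den y) -mulNr.
  rewrite addf_div // -mulrNz -!intrM -intrD ratr_frac ?mulf_neq0 ?denq_neq0 //.
  by rewrite /ratr -mulNr addf_div // -mulrNz -!intrM -intrD.
have ratrM : monoid_morphism (@ratr L).
  split=> [|x y]; first by rewrite /ratr divr1.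
  rewrite -{1}(divq_num_den x) -{1}(divq_num_den y) mulf_div -!intrM.
  by rewrite ratr_frac ?mulf_neq0 ?denq_neq0 // !intrM /ratr mulf_div.
pose m1 := GRing.isZmodMorphism.Build rat L (@ratr L) ratrB.
pose m2 := GRing.isMonoidMorphism.Build rat L (@ratr L) ratrM.
pose g : {rmorphism rat -> L} := HB.pack (@ratr L) m1 m2.
by exists g.
Qed.

Lemma root_Cyclotomic_prim n (Z : L) :
  n.-primitive_root Z -> root (map_poly intr 'Phi_n) Z.
Proof.
move=> prZ; have n_gt0 := prim_order_gt0 prZ.
have Xn1 d : (map_poly intr ('X^d - 1 : {poly int})).[Z] = Z ^+ d - 1.
  by rewrite rmorphB /= map_polyXn rmorph1 !hornerE.
have : root (map_poly intr (\prod_(d <- divisors n) 'Phi_d)) Z.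
  by apply/rootP; rewrite prod_Cyclotomic // Xn1 (prim_expr_order prZ) subrr.
rewrite rmorph_prod /= rootE horner_prod prodf_seq_eq0 => /hasP[d].
rewrite -dvdn_divisors //= => dvd_dn Phid0.
have d_gt0 := dvdn_gt0 n_gt0 dvd_dn.
have : Z ^+ d == 1.
  rewrite -subr_eq0 -Xn1 -prod_Cyclotomic // rmorph_prod horner_prod /=.
  rewrite prodf_seq_eq0; apply/hasP; exists d => //.
  by rewrite -dvdn_divisors.
rewrite -(prim_order_dvd prZ) => dvd_nd.
by have /eqP-> : n == d by rewrite eqn_dvd dvd_nd.
Qed.

(** Irreducibility of ['Phi_n] over the rationals is available in [algC] through minimal
    polynomials. The gcd of [r] and ['Phi_n] has rational coefficients, so their common root in L
    forces one in [algC]. *)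
Lemma Cyclotomic_size_min n (Z : L) (r : {poly rat}) :
  n.-primitive_root Z -> (map_poly ratr r).[Z] = 0 -> (size r <= totient n)%N ->
  r = 0.
Proof.
move=> prZ rZ0; have n_gt0 := prim_order_gt0 prZ.
apply: contraTeq => r_neq0; rewrite -ltnNge.
have [g gE] := exists_ratr_rmorphism.
pose P : {poly rat} := map_poly intr 'Phi_n; pose h := gcdp r P.
have h_neq0 : h != 0 by rewrite gcdp_eq0 negb_and r_neq0.
have : (1 < size h)%N.
  apply: (size_root_gt1 (f := g) (z := Z)) => //; apply: root_gcdp_map.
    by apply/rootP; rewrite -rZ0; congr _.[_]; apply: eq_map_poly.
  rewrite -map_poly_comp (eq_map_poly (g := intr)) ?root_Cyclotomic_prim //.
  by move=> m /=; rewrite rmorph_int.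
rewrite -(size_map_poly (ratr : rat -> algC)) => h_gt1.
have /closed_rootP[z1 rz1] : size (map_poly (ratr : rat -> algC) h) != 1%N.
  by rewrite gtn_eqF.
have [z0 prz0] := C_prim_root_exists n_gt0.
have prz1 : n.-primitive_root z1.
  rewrite -(root_cyclotomic prz0) -Cintr_Cyclotomic //.
  have : root (map_poly (ratr : rat -> algC) P) z1.
    by rewrite -(divpK (dvdp_gcdr r P : h %| P)) rmorphM /= rootM rz1 orbT.
  rewrite -map_poly_comp (eq_map_poly (g := intr)) //.
  by move=> m /=; rewrite rmorph_int.
have [p [minp _] p_dvd] := minCpolyP z1.
have := size_cyclotomic z1 n.
rewrite -minCpoly_cyclotomic // minp size_map_poly => <-.
apply: leq_trans (dvdp_leq h_neq0 _) (dvdp_leq r_neq0 (dvdp_gcdl _ _)).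
by rewrite -p_dvd.
Qed.

End RationalSubfield.

(* The product of the ['X - Z ^+ i] is the image of a polynomial over [Q[X]]. *)
Lemma in_Qadj_coef_prod_XsubC (L : fieldType) (Z : L) (idx : seq nat) j :
  [pchar L] =i pred0 ->
  in_Qadj Z (\prod_(i <- idx) ('X - (Z ^+ i)%:P))`_j.
Proof.
move=> charL; have [g gE] := exists_ratr_rmorphism charL.
pose ev : {rmorphism {poly rat} -> L} := horner_eval Z \o map_poly g.
have [h ->] : exists h, \prod_(i <- idx) ('X - (Z ^+ i)%:P) = map_poly ev h.
  elim: idx => [|i idx [h IH]]; first by exists 1; rewrite big_nil rmorph1.
  exists (('X - ('X^i)%:P) * h); rewrite big_cons IH rmorphM rmorphB /= map_polyX.
  by rewrite map_polyC /= map_polyXn horner_evalE hornerXn.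
exists h`_j; rewrite coef_map /= horner_evalE; congr _.[_].
by apply: eq_map_poly => x; rewrite gE.
Qed.

(* If [Z = q(Z ^+ p)], take the gcd of a polynomial whose roots are the primitive
   [p ^ s.+2]-th roots of unity and of [q('X^p) - 'X]: any root [z] of it is determined
   by [z ^+ p], which bounds the degree. *)
Lemma exists_small_annihilator (F : fieldType) (L : closedFieldType)
    (f : {rmorphism F -> L}) (p s : nat) (Z : L) :
  [pchar F] =i pred0 -> prime p -> (p ^ s.+2).-primitive_root Z ->
  in_adj f (Z ^+ p) Z ->
  exists g : {poly F}, [/\ g != 0, root (map_poly f g) Z,
    (size g <= (totient (p ^ s.+1)).+1)%N & forall j, in_Qadj Z (f g`_j)].
Proof.
move=> charF p_pr prZ [q defZ]; have p_gt0 := prime_gt0 p_pr.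
have charL : [pchar L] =i pred0 by move=> x; rewrite (fmorph_pchar f) charF.
pose Psi (K : fieldType) k : {poly K} := \sum_(i < p) 'X^(p ^ k) ^+ i.
(* [Psi K k] is the cyclotomic polynomial of order [p ^ k.+1], as a polynomial over K. *)
have mapPsi k : map_poly f (Psi F k) = Psi L k.
  by rewrite rmorph_sum; apply: eq_bigr => i _; rewrite rmorphXn /= map_polyXn.
have PsiE (K : fieldType) k (z : K) : (Psi K k).[z] = \sum_(i < p) (z ^+ (p ^ k)) ^+ i.
  by rewrite horner_sum; apply: eq_bigr => i _; rewrite !hornerE.
have dvdPsi k : Psi F k %| 'X^(p ^ k.+1) - 1.
  by rewrite expnSr exprM subrX1 dvdp_mull.
have size_Psi k : (size (Psi L k) <= (totient (p ^ k.+1)).+1)%N.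
  apply: leq_trans (size_sum _ _ _) _; apply/bigmax_leqP => i _.
  rewrite -exprM size_polyXn ltnS totient_pfactor //= mulnC leq_mul2r.
  by rewrite -ltnS prednK // ltn_ord orbT.
have Psi_neq0 (K : fieldType) k : [pchar K] =i pred0 -> Psi K k != 0.
  move=> charK; apply: contraTneq isT => Psi0; have := PsiE K k 1.
  rewrite Psi0 horner0 expr1n (eq_bigr (fun=> 1)); last by move=> i _; rewrite expr1n.
  rewrite sumr_const card_ord => /esym/eqP.
  by rewrite (pcharf0P _).1 // gtn_eqF.
have PsiZ : root (Psi L s.+1) Z.
  have prw : (p ^ 1).-primitive_root (Z ^+ (p ^ s.+1)) by apply: prim_root_pow; rewrite // add1n.
  have w_neq1 : Z ^+ (p ^ s.+1) != 1.
    have := prim_order_dvd prw 1; rewrite expr1 => <-.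
    by rewrite expn1 dvdn1 gtn_eqF ?prime_gt1.
  apply/rootP; rewrite PsiE; apply/eqP.
  rewrite -(mulrI_eq0 _ (mulfI _ : GRing.lreg (Z ^+ (p ^ s.+1) - 1))).
    by rewrite -subrX1 -exprM -expnSr (prim_expr_order prZ) subrr.
  by rewrite subr_eq0.
pose g0 := gcdp (Psi F s.+1) (q \Po 'X^p - 'X).
have g0_neq0 : g0 != 0 by rewrite gcdp_eq0 negb_and Psi_neq0.
have c_neq0 : (lead_coef g0)^-1 != 0 by rewrite invr_eq0 lead_coef_eq0.
pose g := (lead_coef g0)^-1 *: g0.
have lead_g : lead_coef g = 1 by rewrite lead_coefZ mulVf ?lead_coef_eq0.
have rg : root (map_poly f g) Z.
  rewrite map_polyZ rootZ ?fmorph_eq0 //; apply: root_gcdp_map; first by rewrite mapPsi.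
  apply/rootP; rewrite rmorphB /= map_polyX map_comp_poly map_polyXn.
  by rewrite !hornerE horner_comp hornerXn -defZ subrr.
have g_Psi : g %| Psi F s.+1 by rewrite dvdpZl // dvdp_gcdl.
have g_q : g %| q \Po 'X^p - 'X by rewrite dvdpZl // dvdp_gcdr.
have n_neq0 : (p ^ s.+2)%:R != 0 :> F by rewrite (pcharf0P _).1 // expn_eq0 negb_and -lt0n p_gt0.
have [rs] := closed_field_poly_normal (map_poly f g).
rewrite lead_coef_map lead_g rmorph1 scale1r => def_g.
have rs_root z : z \in rs -> root (map_poly f g) z by rewrite def_g root_prod_XsubC.
have uniq_rs : uniq rs.
  rewrite -separable_prod_XsubC -def_g separable_map.
  exact: dvdp_separable (dvdp_trans g_Psi (dvdPsi _)) (separable_Xn_sub_1 n_neq0).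
have root_dvd (h k : {poly F}) z : h %| k -> root (map_poly f h) z -> root (map_poly f k) z.
  by case/dvdpP=> r ->; rewrite rmorphM rootM orbC => ->.
have rs_q z : z \in rs -> z = (map_poly f q).[z ^+ p].
  move/rs_root/(root_dvd _ _ _ g_q); rewrite rmorphB /= map_polyX map_comp_poly map_polyXn.
  by rewrite rootE !hornerE horner_comp hornerXn subr_eq0 => /eqP.
have rs_Psi z : z \in rs -> root (Psi L s.+1) z.
  by move/rs_root/(root_dvd _ _ _ g_Psi); rewrite mapPsi.
(* The roots of [g] are powers of [Z], which puts its coefficients in the field generated by [Z]
   over the rationals, besides being in F. *)
have [idx def_rs] : exists idx, rs = [seq Z ^+ i | i <- idx].
  have : {in rs, forall z, z ^+ (p ^ s.+2) = 1}.
    move=> z /rs_root/(root_dvd _ _ _ (dvdp_trans g_Psi (dvdPsi _))).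
    by rewrite rmorphB /= map_polyXn rmorph1 rootE !hornerE subr_eq0 => /eqP.
  elim: (rs) => [|z r IHr] rs1; first by exists [::].
  have [|idx ->] := IHr; first by move=> y y_r; rewrite rs1 // inE y_r orbT.
  have [i ->] := prim_rootP prZ (rs1 z (mem_head _ _)).
  by exists (val i :: idx).
exists g; split => //; first by rewrite scaler_eq0 negb_or c_neq0.
  (* The p-th powers of the roots are distinct, since [q] recovers each root, and they are roots of
     [Psi L s]. *)
  rewrite -(size_map_poly f) def_g size_prod_XsubC ltnS -(size_map (fun z => z ^+ p)).
  rewrite -ltnS (leq_trans _ (size_Psi s)) //; apply: max_poly_roots.
  - exact: Psi_neq0.
  - apply/allP=> _ /mapP[z z_rs ->]; have /rootP := rs_Psi z z_rs.
    by rewrite rootE !PsiE -exprM -expnS => ->.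
  - rewrite map_inj_in_uniq // => x y x_rs y_rs xy.
    by rewrite (rs_q x) // (rs_q y) // xy.
move=> j; rewrite -coef_map def_g def_rs big_map.
exact: in_Qadj_coef_prod_XsubC.
Qed.

(** The small annihilator of [Z] has degree at most [p - 1], and its coefficients can be written
    [c j (Z ^+ p)] with [c j] rational of degree at most [p - 2]. Then the sum of the
    [c j (Z ^+ p) * Z ^+ j] is a rational polynomial in [Z] of degree less than [p * (p - 1)], the
    degree of [Z], so it vanishes. The exponents [k * p + j] do not overlap, so all [c j] vanish. *)
Lemma notin_adj_odd (F : fieldType) (L : closedFieldType)
    (f : {rmorphism F -> L}) (p : nat) (Z : L) :
  [pchar F] =i pred0 -> prime p -> (p ^ 2).-primitive_root Z ->
  (forall x, in_Qadj Z (f x) -> in_Qadj (Z ^+ p) (f x)) ->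
  ~ in_adj f (Z ^+ p) Z.
Proof.
move=> charF p_pr prZ hyp adjZ; have p_gt0 := prime_gt0 p_pr.
have charL : [pchar L] =i pred0 by move=> x; rewrite (fmorph_pchar f) charF.
have [R RE] := exists_ratr_rmorphism charL.
have [g [g_neq0 rg sz_g coef_g]] := exists_small_annihilator charF p_pr prZ adjZ.
have prth : (p ^ 1).-primitive_root (Z ^+ (p ^ 1)) by apply: prim_root_pow.
rewrite !expn1 in prth; rewrite expn1 totient_prime // prednK // in sz_g.
pose P : {poly rat} := map_poly intr 'Phi_p.
have sz_P : size P = p.
  by rewrite size_map_inj_poly ?size_Cyclotomic ?totient_prime ?prednK //; apply: intr_inj.
have P_neq0 : P != 0 by rewrite -size_poly_gt0 sz_P.
have rP : (map_poly R P).[Z ^+ p] = 0.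
  rewrite -map_poly_comp (eq_map_poly (g := intr)); last by move=> m /=; rewrite rmorph_int.
  exact/rootP/root_Cyclotomic_prim.
have c_ex j : exists c : {poly rat}, (size c < p)%N /\ f g`_j = (map_poly R c).[Z ^+ p].
  have [c def_c] := hyp _ (coef_g j); exists (c %% P); split.
    by rewrite -[X in (_ < X)%N]sz_P ltn_modp.
  rewrite def_c (eq_map_poly (g := R)) // {1}(divp_eq c P) rmorphD rmorphM /=.
  by rewrite hornerD hornerM rP mulr0 add0r.
have [c cP] := choice c_ex.
pose r : {poly rat} := \sum_(j < p) (c j \Po 'X^p) * 'X^j.
have rZ : (map_poly ratr r).[Z] = 0.
  rewrite (eq_map_poly (g := R)) // rmorph_sum horner_sum.
  rewrite -[RHS](rootP rg) (horner_coef_wide _ (n := p)) ?size_map_poly //.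
  apply: eq_bigr => j _; rewrite coef_map /= (cP j).2 rmorphM /=.
  by rewrite map_comp_poly !map_polyXn hornerM horner_comp !hornerXn.
have sz_r : (size r <= totient (p ^ 2))%N.
  apply: leq_trans (size_sum _ _ _) _; apply/bigmax_leqP => j _.
  rewrite totient_pfactor //= expn1.
  apply: leq_trans (size_polyMleq _ _) _; rewrite size_polyXn addnS /=.
  have lt_c := (cP j).1; have lt_j := ltn_ord j.
  have le_comp := size_comp_poly_leq (c j) 'X^p; rewrite size_polyXn /= in le_comp.
  apply: leq_trans (leq_add le_comp (leqnn j)) _.
  apply: leq_trans (_ : (p.-2 * p + p <= _)%N); last first.
    by case: (p) p_pr => [|[|k]] //= _; rewrite -mulSnr leqnn.
  have le_pred a b : (a < b -> a.-1 <= b.-2)%N by case: a b => [|a] [|[|b]].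
  by rewrite addSnnS leq_add // leq_mul2r le_pred ?orbT.
have r0 := Cyclotomic_size_min charL prZ rZ sz_r.
case/negP: g_neq0; apply/eqP/polyP => j; rewrite coef0.
have [lt_jp|le_pj] := ltnP j p; last by rewrite nth_default // (leq_trans sz_g).
apply: (fmorph_inj f); rewrite rmorph0 (cP j).2.
suff -> : c j = 0 by rewrite rmorph0 horner0.
apply/polyP => k; rewrite coef0.
have := congr1 (fun u : {poly rat} => u`_(k * p + j)) r0.
rewrite coef_sum coef0 (bigD1 (Ordinal lt_jp)) //= coefMXn ltnNge leq_addl /=.
rewrite addnK coef_comp_poly_Xn // dvdn_mull // mulnK // big1 ?addr0 // => i ne_ij.
rewrite coefMXn; case: ltnP => // le_i; rewrite coef_comp_poly_Xn //.
case: ifP => // /dvdnP[l el].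
have e : (k * p + j = l * p + i)%N by rewrite -el subnK.
case/eqP: ne_ij; apply: val_inj => /=.
by rewrite -(modn_small (ltn_ord i)) -(modn_small lt_jp) -(modnMDl k j) e modnMDl.
Qed.

(** The small annihilator has degree at most 2 and now rational coefficients, whereas [Z] has degree
    4 over the rationals. *)
Lemma notin_adj_even (F : fieldType) (L : closedFieldType)
    (f : {rmorphism F -> L}) (Z : L) :
  [pchar F] =i pred0 -> 8.-primitive_root Z ->
  (forall x, in_Qadj Z (f x) -> exists r : rat, f x = ratr r) ->
  ~ in_adj f (Z ^+ 2) Z.
Proof.
move=> charF prZ hyp adjZ.
have charL : [pchar L] =i pred0 by move=> x; rewrite (fmorph_pchar f) charF.
have [R RE] := exists_ratr_rmorphism charL.
have [g [g_neq0 rg sz_g coef_g]] :=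
  @exists_small_annihilator _ _ f 2 1 Z charF isT prZ adjZ.
have [c cP] := choice (fun j => hyp _ (coef_g j)).
pose r : {poly rat} := \poly_(j < size g) c j.
have def_r : map_poly ratr r = map_poly f g.
  apply/polyP => j; rewrite (eq_map_poly (g := R)) // !coef_map coef_poly.
  case: ltnP => [_|le_gj]; first by rewrite /= cP RE.
  by rewrite /= (nth_default _ le_gj) !rmorph0.
have rZ : (map_poly ratr r).[Z] = 0 by rewrite def_r; apply/rootP.
have sz_r : (size r <= totient 8)%N.
  exact: leq_trans (size_poly _ _) (leq_trans sz_g _).
have r0 := Cyclotomic_size_min charL prZ rZ sz_r.
case/negP: g_neq0; rewrite -(map_poly_eq0 f) -def_r r0.
by rewrite (eq_map_poly (g := R)) // rmorph0.
Qed.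

Lemma exists_prim_root (L : closedFieldType) n :
  [pchar L] =i pred0 -> (0 < n)%N -> exists z : L, n.-primitive_root z.
Proof.
move=> charL n_gt0.
have [rs] := closed_field_poly_normal ('X^n - 1 : {poly L}).
rewrite -{2}polyC1 lead_coefXnsubC // scale1r => def_rs.
have n_neq0 : n%:R != 0 :> L by rewrite (pcharf0P _).1 // -lt0n.
suff /hasP[z _ prz] : has n.-primitive_root rs by exists z.
apply: has_prim_root => //.
- by apply/allP=> z z_rs; rewrite /root_of_unity def_rs root_prod_XsubC.
- by rewrite -separable_prod_XsubC -def_rs separable_Xn_sub_1.
- have := congr1 (fun P : {poly L} => size P) def_rs.
  by rewrite size_prod_XsubC -polyC1 size_XnsubC // => -[->].
Qed.

(** The case of [in_adj_tower] whose base field is F with the root of order [p ^ m] adjoined. *)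
Lemma in_adj_tower_adj (F L : fieldType) (f : {rmorphism F -> L}) (p m n : nat) (Z : L) :
  prime p -> (p = 2%N -> (1 < m)%N) -> (0 < m)%N ->
  (p ^ (m + n.+1)).-primitive_root Z ->
  ~ in_adj f (Z ^+ (p ^ n.+1)) (Z ^+ (p ^ n)) -> ~ in_adj f (Z ^+ p) Z.
Proof.
move=> p_pr m_gt1 m_gt0 prZ notadj [q defZ].
have N_gt0 : (0 < p ^ (m + n.+1))%N by rewrite expn_gt0 prime_gt0.
have A_neq0 : 'X^(p ^ (m + n.+1)) - 1%:P != 0 :> {poly F}.
  by rewrite -size_poly_gt0 size_XnsubC.
have rA : root (map_poly f ('X^(p ^ (m + n.+1)) - 1%:P)) (Z ^+ (p ^ n.+1)).
  apply/rootP; rewrite rmorphB /= map_polyXn map_polyC !hornerE /= rmorph1 exprAC.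
  by rewrite (prim_expr_order prZ) expr1n subrr.
have [K [i [j [ji jK]]]] := exists_adjunction A_neq0 rA.
apply: (in_adj_tower (f := j) p_pr m_gt1 m_gt0 prZ).
- by apply/jK; exists 'X; rewrite map_polyX hornerX.
- by move=> x; apply/eqP=> jx; apply: notadj; apply/jK; exists x.
by exists (map_poly i q); rewrite -map_poly_comp (eq_map_poly (g := f)).
Qed.

(* For [k <= m < B] with [m > 0], adjoining the [p ^ m]-th roots of unity to [F]
   does not bring in those of order [p ^ m.+1]. *)
Lemma cyclotomic_level (F : fieldType) (L : closedFieldType)
    (f : {rmorphism F -> L}) (p B : nat) :
  [pchar F] =i pred0 -> prime p ->
  (odd p ->
     (exists z : F, p.-primitive_root z) \/
     (forall z w : L, (p ^ 2)%N.-primitive_root z -> p.-primitive_root w ->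
        forall x : F, in_Qadj z (f x) -> in_Qadj w (f x))) ->
  (p = 2%N ->
     (exists z : F, 4.-primitive_root z) \/
     (forall z : L, 8.-primitive_root z ->
        forall x : F, in_Qadj z (f x) -> exists r : rat, f x = ratr r)) ->
  exists2 k, (exists z : F, (p ^ k).-primitive_root z) &
    forall m (Z : L), (k <= m)%N -> (0 < m < B)%N -> (p ^ m.+1).-primitive_root Z ->
    ~ in_adj f (Z ^+ p) Z.
Proof.
move=> charF p_pr hyp_odd hyp_even.
have charL : [pchar L] =i pred0 by move=> x; rewrite (fmorph_pchar f) charF.
have base k0 (z : F) : (p = 2%N -> 1 < k0)%N -> (0 < k0)%N ->
    (p ^ k0).-primitive_root z ->
  exists2 k, (exists z : F, (p ^ k).-primitive_root z) &
    forall m (Z : L), (k <= m)%N -> (0 < m < B)%N -> (p ^ m.+1).-primitive_root Z ->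
    ~ in_adj f (Z ^+ p) Z.
  move=> k0_gt1 k0_gt0 prz.
  (* F may contain roots of unity of every [p]-power order, so the maximal [k] is taken below a cap;
     this limits the conclusion to levels below [B]. *)
  pose P j := `[< exists z : F, (p ^ j).-primitive_root z >] && (j <= maxn B k0)%N.
  have exP : exists j, P j.
    by exists k0; rewrite /P leq_maxr andbT; apply/asboolP; exists z.
  have ubP j : P j -> (j <= maxn B k0)%N by case/andP.
  have [k /andP[/asboolP[zk przk] k_le] k_max] := ex_maxnP exP ubP.
  have le_k0k : (k0 <= k)%N.
    by apply: k_max; rewrite /P leq_maxr andbT; apply/asboolP; exists z.
  exists k; first by exists zk.
  move=> m Z le_km /andP[_ lt_mB] prZ.
  have def_m : (m.+1 = k + (m - k).+1)%N by rewrite addnS subnKC.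
  rewrite def_m in prZ.
  apply: (in_adj_tower_adj p_pr _ _ prZ).
  - by move=> p2; apply: leq_trans (k0_gt1 p2) le_k0k.
  - exact: leq_trans k0_gt0 le_k0k.
  have prF : (p ^ k).-primitive_root (f zk) by rewrite fmorph_primitive_root.
  have prZk : (p ^ k).-primitive_root (Z ^+ (p ^ (m - k).+1)) by apply: prim_root_pow.
  have [i ->] := prim_rootP prF (prim_expr_order prZk).
  case=> q; rewrite -rmorphXn horner_map => def_Z.
  suff /k_max : P k.+1 by rewrite ltnn.
  rewrite /P (leq_trans _ (leq_maxl _ _)) ?andbT; last exact: leq_ltn_trans lt_mB.
  apply/asboolP; exists q.[zk ^+ i]; rewrite -(fmorph_primitive_root f) -def_Z.
  by apply: prim_root_pow; rewrite // addSnnS.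
have prim1 : exists z : F, (p ^ 0).-primitive_root z.
  have [l] := prim_order_exists (ltn0Sn 0) (expr1 (1 : F)).
  by rewrite dvdn1 => pr1 /eqP l1; exists 1; rewrite expn0 -l1.
have [p2|p_odd] := even_prime p_pr; last first.
  have [[z prz]|hyp] := hyp_odd p_odd.
    apply: (base 1%N z); rewrite ?expn1 //.
    by move=> p2; rewrite p2 in p_odd.
  (* Here the tower starts over F(zeta_p), and [notin_adj_odd] is its first step. *)
  exists 0%N => // m Z _ /andP[m_gt0 _] prZ.
  have def_m : (m.+1 = 1 + m.-1.+1)%N by rewrite prednK.
  rewrite def_m in prZ.
  apply: (in_adj_tower_adj p_pr _ _ prZ) => //; first by move=> p2; rewrite p2 in p_odd.
  have prZ2 : (p ^ 2).-primitive_root (Z ^+ (p ^ m.-1)).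
    by apply: prim_root_pow; rewrite // addSnnS.
  rewrite expnSr exprM; apply: notin_adj_odd => // x.
  apply: hyp => //; rewrite -exprM -expnSr -{1}(expn1 p).
  exact: prim_root_pow.
have [[z prz]|hyp] := hyp_even p2.
  by apply: (base 2%N z); rewrite ?p2.
rewrite {}p2 in p_pr prim1 *; exists 0%N => // m Z _ /andP[m_gt0 _] prZ.
(* For [p = 2] the tower must start from a root of order 4, so level 1 is treated apart: since F(-1)
   = F, a root of order 4 would lie in F, hence be a rational number with square -1. *)
have [m1|m_gt1] := leqP m 1.
  have {m_gt0 m1} m1 : m = 1%N by apply/eqP; rewrite eqn_leq m1.
  rewrite m1 in prZ.
  have Z2 : Z ^+ 2 = -1.
    have pr2 : (2 ^ 1).-primitive_root (Z ^+ (2 ^ 1)) by apply: prim_root_pow.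
    have := prim_expr_order pr2; rewrite !expn1 => /eqP.
    rewrite sqrf_eq1 => /orP[/eqP a1|/eqP//].
    by have := prim_order_dvd pr2 1; rewrite expr1 expn1 a1 eqxx.
  rewrite Z2 => -[q]; rewrite -(rmorphN1 f) horner_map => def_Z.
  have [Z8 prZ8] := exists_prim_root charL (isT : (0 < 8)%N).
  have pr4 : (2 ^ 2).-primitive_root (Z8 ^+ (2 ^ 1)) by apply: prim_root_pow.
  have [i def_i] := prim_rootP pr4 (prim_expr_order prZ).
  have [R RE] := exists_ratr_rmorphism charL.
  have [|r] := hyp _ prZ8 q.[-1].
    exists ('X^(2 ^ 1 * i)); rewrite (eq_map_poly (g := R)) // map_polyXn hornerXn.
    by rewrite exprM -def_i -def_Z.
  rewrite -def_Z -RE => def_r; move/eqP: Z2; rewrite def_r -rmorphXn -(rmorphN1 R).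
  rewrite (inj_eq (fmorph_inj R)) => /eqP r2.
  by have := sqr_ge0 r; rewrite r2.
have def_m : (m.+1 = 2 + (m.-2).+1)%N by case: m m_gt0 m_gt1 {prZ} => [|[|m]].
rewrite def_m in prZ.
apply: (in_adj_tower_adj p_pr _ _ prZ) => //.
rewrite expnSr exprM; apply: notin_adj_even => //; last first.
  by apply: hyp; apply: (prim_root_pow (m := 3) p_pr); rewrite addSnnS.
by apply: (prim_root_pow (m := 3) p_pr); rewrite addSnnS.
Qed.

(** * Coordinates on a finite abelian group *)

(* [x] generates, [x i] has order [d i], and [c i g] is the [i]-th coordinate of [g], only
   meaningful modulo [d i]. Trivial factors are allowed, so that two groups can be given
   the same number [N] of coordinates. *)
Record coordinates (gT : finGroupType) (N : nat) (d : nat -> nat)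
    (x : 'I_N -> gT) (c : 'I_N -> gT -> nat) : Prop := Coordinates {
  coord_gt0 : forall i, (0 < d i)%N;
  coord_dvd : forall i j, (i <= j)%N -> (d j %| d i)%N;
  coord_expg : forall i : 'I_N, (x i ^+ d i = 1)%g;
  coord_mul : forall (i : 'I_N) g h, c i (g * h)%g = (c i g + c i h)%N %[mod d i];
  coord_gen : forall i j : 'I_N, c i (x j) = (i == j) %[mod d i];
  coord_prod : forall g, g = (\prod_i x i ^+ c i g)%g }.

Lemma prodgM (gT : finGroupType) (I : Type) (r : seq I) (F G : I -> gT) :
  abelian [set: gT] ->
  (\prod_(i <- r) (F i * G i) = (\prod_(i <- r) F i) * (\prod_(i <- r) G i))%g.
Proof.
move=> /centsP abelG; elim: r => [|i r IHr]; first by rewrite !big_nil mulg1.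
rewrite !big_cons IHr !mulgA; congr (_ * _)%g; rewrite -!mulgA; congr (_ * _)%g.
by apply: abelG; rewrite inE.
Qed.

Lemma bigdprod_abelian_type (gT : finGroupType) : abelian [set: gT] ->
  exists M, forall N, (M <= N)%N -> exists2 x : 'I_N -> gT,
    (\big[dprod/1]_(i < N) <[x i]> = [set: gT])%g &
    forall i, #[x i]%g = nth 1%N (abelian_type [set: gT]) i.
Proof.
move=> abelG; have [b defG <-] := abelian_structure abelG.
exists (size b) => N le_bN; exists (fun i => nth 1%g b i) => [|i].
  rewrite -defG [in RHS](big_nth 1%g) big_mkord (big_ord_widen _ (fun i => <[nth 1 b i]>%g) le_bN).
  rewrite [RHS]big_mkcond; apply: eq_bigr => i _; case: ltnP => // le_bi.
  by rewrite nth_default // cycle1.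
have [lt_ib|le_bi] := ltnP i (size b); first by rewrite (nth_map 1%g).
by rewrite !nth_default ?size_map // order1.
Qed.

Lemma exists_coordinates (gT : finGroupType) : abelian [set: gT] ->
  exists M, forall N, (M <= N)%N -> exists (d : nat -> nat) (x : 'I_N -> gT) c,
    coordinates d x c.
Proof.
move=> abelG; have [M exM] := bigdprod_abelian_type abelG.
exists M => N /exM[x defG ox]; set d := nth 1%N _ in ox.
have decomp g : exists a : 'I_N -> nat, g = (\prod_i x i ^+ a i)%g.
  have [e [e_in def_g _]] := mem_bigdprod defG (in_setT g).
  have [a aP] := choice (fun i => cycleP _ _ (e_in i isT) : exists k, _).
  by exists a; rewrite def_g; apply: eq_bigr => i _.
have uniq_decomp (a b : 'I_N -> nat) :
    (\prod_i x i ^+ a i = \prod_i x i ^+ b i)%g -> forall i, a i = b i %[mod d i].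
  move=> ab i; have [e [_ _ e_uniq]] := mem_bigdprod defG (in_setT (\prod_i x i ^+ a i)%g).
  apply/eqP; rewrite -ox -eq_expg_mod_order; apply/eqP.
  rewrite (e_uniq (fun i => x i ^+ a i)%g) //; last by move=> j _; apply: mem_cycle.
  by rewrite (e_uniq (fun i => x i ^+ b i)%g) // => j _; apply: mem_cycle.
have [c cP] := choice decomp.
exists d, x, (fun i g => c g i); split=> //.
- move=> i; rewrite /d; have [lt_i|le_i] := ltnP i (size (abelian_type [set: gT])).
    apply: ltnW; apply: (allP (abelian_type_gt1 _)).
    exact: mem_nth.
  by rewrite nth_default.
- move=> i j le_ij; rewrite /d.
  have [lt_j|le_j] := ltnP j (size (abelian_type [set: gT])); last first.
    by rewrite [X in (X %| _)%N]nth_default ?dvd1n.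
  have tr : transitive (fun m n => n %| m)%N by move=> m n k mn nk; apply: dvdn_trans nk mn.
  apply: (sorted_leq_nth tr _ 1%N (abelian_type_dvdn_sorted [set: gT])) => //.
  by rewrite inE (leq_ltn_trans le_ij).
- by move=> i; rewrite -ox expg_order.
- move=> i g h; apply: (uniq_decomp _ (fun i => c g i + c h i)%N).
  rewrite -cP {1}(cP g) {1}(cP h) -prodgM //.
  by apply: eq_bigr => j _; rewrite expgD.
move=> i j; apply: (uniq_decomp _ (fun i => i == j : nat)); rewrite -(cP (x j)).
transitivity (\prod_(i | i == j) x i)%g; first by rewrite big_pred1_eq.
rewrite big_mkcond; apply: eq_bigr => k _.
by case: eqP => [->|_]; rewrite ?expg1 ?expg0.
Qed.

Section CoordinatesTheory.

Variables (gT : finGroupType) (N : nat) (d : nat -> nat).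
Variables (x : 'I_N -> gT) (c : 'I_N -> gT -> nat).
Hypothesis cG : coordinates d x c.

Lemma coord1 i : c i 1%g = 0 %[mod d i].
Proof.
apply/eqP; rewrite -(eqn_modDl (c i 1%g)) addn0 eq_sym.
by apply/eqP; rewrite -(coord_mul cG) mulg1.
Qed.

Lemma coord_exp i g n : c i (g ^+ n)%g = (n * c i g)%N %[mod d i].
Proof.
elim: n => [|n IHn]; first by rewrite expg0 coord1.
by rewrite expgS (coord_mul cG) -modnDmr IHn modnDmr mulSn.
Qed.

Lemma coord_of_prod (a : 'I_N -> nat) i :
  c i (\prod_j x j ^+ a j)%g = a i %[mod d i].
Proof.
have -> : a i = (\sum_j a j * (i == j))%N.
  rewrite (bigD1 i) //= eqxx muln1 big1 ?addn0 // => j /negPf.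
  by rewrite eq_sym => ->; rewrite muln0.
elim/big_rec2: _ => [|j y g _ IH]; first exact: coord1.
rewrite (coord_mul cG) -modnDm IH coord_exp modnDm -modnDml -modnMmr.
by rewrite (coord_gen cG) modnMmr modnDml.
Qed.

Lemma coord_inj g h : (forall i, c i g = c i h %[mod d i]) -> g = h.
Proof.
move=> gh; rewrite (coord_prod cG g) (coord_prod cG h); apply: eq_bigr => i _.
by rewrite -[LHS](expg_mod _ (coord_expg cG i)) gh expg_mod // (coord_expg cG).
Qed.

Lemma coord_dvd_order (i : 'I_N) : (d i %| #[x i]%g)%N.
Proof.
apply/eqP; rewrite -(mod0n (d i)) -(coord1 i) -(expg_order (x i)) coord_exp.
by rewrite -modnMmr (coord_gen cG) eqxx modnMmr muln1.
Qed.

Lemma morph_coord (L : comNzRingType) (chi : gT -> L) :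
  chi 1%g = 1 -> (forall g h, chi (g * h)%g = chi g * chi h) ->
  forall g, chi g = \prod_i chi (x i) ^+ c i g.
Proof.
move=> chi1 chiM g; rewrite {1}(coord_prod cG g) (big_morph chi chiM chi1).
apply: eq_bigr => i _; elim: (c i g) => [|n IHn]; first by rewrite expg0.
by rewrite expgS chiM IHn exprS.
Qed.

End CoordinatesTheory.

Lemma isog_coordinates (gT hT : finGroupType) N d e
    (x : 'I_N -> gT) c (y : 'I_N -> hT) k :
  abelian [set: hT] -> coordinates d x c -> coordinates e y k ->
  (forall i, (i < N)%N -> d i = e i) -> [set: gT] \isog [set: hT].
Proof.
move=> abelH cG cH de.
pose phi g := (\prod_i y i ^+ c i g)%g.
have phiE g (i : 'I_N) : k i (phi g) = c i g %[mod e i] by apply: coord_of_prod cH _ _.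
have phiM : {in [set: gT] &, {morph phi : g h / (g * h)%g}}.
  move=> g h _ _; apply: (coord_inj cH) => i.
  rewrite phiE (coord_mul cH) -[RHS]modnDm !phiE modnDm -de //.
  exact: (coord_mul cG).
apply/isogP; exists (Morphism phiM).
  apply/injmP=> g h _ _ /= gh; apply: (coord_inj cG) => i.
  by rewrite de // -!phiE gh.
apply/setP=> h; rewrite inE; apply/morphimP.
exists (\prod_i x i ^+ k i h)%g; rewrite ?inE //=.
by apply: (coord_inj cH) => i; rewrite phiE -de // (coord_of_prod cG).
Qed.

Lemma card_ord_multiples m k : (0 < m)%N ->
  #|[pred a : 'I_(m * k) | m %| a]%N| = k.
Proof.
move=> m_gt0.
have lt_mul (i : 'I_k) : (m * i < m * k)%N by rewrite ltn_pmul2l.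
have inj : injective (fun i => Ordinal (lt_mul i)).
  by move=> i j [] /eqP; rewrite eqn_pmul2l // => /eqP ij; apply: val_inj.
rewrite -[RHS]card_ord -(card_codom inj); apply: eq_card => a; rewrite inE.
apply/idP/codomP=> [/dvdnP[q def_a]|[i ->]]; last exact: dvdn_mulr.
have lt_qk : (q < k)%N by rewrite -(ltn_pmul2l m_gt0) (mulnC m q) -def_a.
by exists (Ordinal lt_qk); apply: val_inj; rewrite /= def_a mulnC.
Qed.

(** Counts the homomorphisms from a cyclic group of order [d] to one of order [E]: the solutions are
    the multiples of [E %/ gcdn E d]. *)
Lemma card_ord_dvd_mul E d : (0 < E)%N -> #|[pred a : 'I_E | E %| d * a]%N| = gcdn E d.
Proof.
move=> E_gt0; have g_gt0 : (0 < gcdn E d)%N by rewrite gcdn_gt0 E_gt0.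
set g := gcdn E d in g_gt0 *; pose m := (E %/ g)%N.
have def_E : E = (m * g)%N by rewrite divnK ?dvdn_gcdl.
have def_d : d = (d %/ g * g)%N by rewrite divnK ?dvdn_gcdr.
have m_gt0 : (0 < m)%N by move: E_gt0; rewrite def_E muln_gt0 => /andP[].
have co : coprime m (d %/ g).
  by rewrite /coprime -(eqn_pmul2r g_gt0) muln_gcdl -def_E -def_d mul1n.
rewrite -[RHS](card_ord_multiples _ m_gt0) -def_E; apply: eq_card => a; rewrite !inE.
by rewrite {1}def_E {1}def_d mulnAC dvdn_pmul2r // Gauss_dvdr.
Qed.

(** The same count for homomorphisms into the cyclic group of order [m * w] whose image lies in its
    subgroup of order [w]. *)
Lemma card_ord_dvd_mul_multiples w m d : (0 < w)%N -> (0 < m)%N ->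
  #|[pred a : 'I_(m * w) | (m * w %| d * a) && (m %| a)]%N| = gcdn w d.
Proof.
move=> w_gt0 m_gt0; rewrite -(card_ord_dvd_mul _ w_gt0).
have lt_mul (i : 'I_w) : (m * i < m * w)%N by rewrite ltn_pmul2l.
have inj : injective (fun i => Ordinal (lt_mul i)).
  by move=> i j [] /eqP; rewrite eqn_pmul2l // => /eqP ij; apply: val_inj.
rewrite -(card_image inj); apply: eq_card => a; rewrite inE.
apply/andP/imageP=> [[mw_a /dvdnP[q def_a]]|[i i_in ->]].
  have lt_qw : (q < w)%N by rewrite -(ltn_pmul2l m_gt0) (mulnC m q) -def_a.
  exists (Ordinal lt_qw); last by apply: val_inj; rewrite /= def_a mulnC.
  by move: mw_a; rewrite inE /= def_a (mulnC q m) mulnCA dvdn_pmul2l.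
by rewrite inE in i_in; rewrite /= mulnCA dvdn_pmul2l // i_in dvdn_mulr.
Qed.

(* Each side is the sum over the related pairs of the inverse of the common
   class size. *)
Lemma card_eq_of_classes (A B : finType) (P : pred A) (Q : pred B) (r : A -> B -> bool) :
  (forall a, P a -> exists2 b, Q b & r a b) ->
  (forall b, Q b -> exists2 a, P a & r a b) ->
  (forall a b, P a -> Q b -> r a b ->
     #|[pred b' | Q b' && r a b']| = #|[pred a' | P a' && r a' b]|) ->
  #|P| = #|Q|.
Proof.
move=> exPQ exQP cardE.
pose s a : rat := #|[pred b | Q b && r a b]|%:R.
pose t b : rat := #|[pred a | P a && r a b]|%:R.
have sumP : #|P|%:R = \sum_(a | P a) \sum_(b | Q b && r a b) (s a)^-1.
  rewrite -sum1_card natr_sum; apply: eq_bigr => a Pa.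
  rewrite sumr_const -[RHS]mulr_natr mulVf //.
  have [b Qb rab] := exPQ a Pa.
  by rewrite pnatr_eq0 -lt0n; apply/card_gt0P; exists b; rewrite inE Qb.
have sumQ : #|Q|%:R = \sum_(b | Q b) \sum_(a | P a && r a b) (t b)^-1.
  rewrite -sum1_card natr_sum; apply: eq_bigr => b Qb.
  rewrite sumr_const -[RHS]mulr_natr mulVf //.
  have [a Pa rab] := exQP b Qb.
  by rewrite pnatr_eq0 -lt0n; apply/card_gt0P; exists a; rewrite inE Pa.
apply/eqP; rewrite -(eqr_nat rat) sumP sumQ; apply/eqP.
rewrite (exchange_big_dep Q) /=; last by move=> a b _ /andP[].
apply: eq_bigr => b Qb; apply: eq_big => [a|a /and3P[Pa _ rab]]; first by rewrite Qb.
by rewrite /s /t (cardE a b).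
Qed.

(** * Characters and the group algebra *)

Section GroupAlgebra.

Variables (F : comUnitRingType) (gT : finGroupType).

Definition trivial_cocycle (g h : gT) : F := 1.

Definition galg_scale (t : F) (u : {ffun gT -> F}) : {ffun gT -> F} :=
  [ffun g => t * u g].

Definition galg_elt (g : gT) : {ffun gT -> F} := [ffun x => (x == g)%:R].

End GroupAlgebra.

Arguments trivial_cocycle {F gT}.

Section Characters.

Variables (F : fieldType) (L : fieldType) (f : {rmorphism F -> L}).
Variables (gT : finGroupType) (N : nat) (d : nat -> nat).
Variables (x : 'I_N -> gT) (c : 'I_N -> gT -> nat).
Hypothesis cG : coordinates d x c.
Variables (E : nat) (Z : L).
Hypothesis prZ : E.+1.-primitive_root Z.
Hypothesis d_dvd : forall i, (d i %| E.+1)%N.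

Implicit Types (a b : {ffun 'I_N -> 'I_E.+1}) (u v w : {ffun gT -> F}).

(* A character is encoded by the exponents [a i] of its values [Z ^+ a i] at the [x i]. *)
Definition is_char a := [forall i : 'I_N, E.+1 %| d i * a i]%N.

Definition chr a (g : gT) : L := \prod_i Z ^+ (a i * c i g).

Definition ext a u : L := \sum_g f (u g) * chr a g.

(** For a character [a] this is the field generated over F by its values; [ext_unit] supplies the
    inverses. *)
Definition in_image a (y : L) := exists u, ext a u = y.

Lemma is_charP a : reflect (forall i : 'I_N, Z ^+ (d i * a i) = 1) (is_char a).
Proof.
apply: (iffP forallP) => aP i; last by rewrite (prim_order_dvd prZ) aP.
by apply/eqP; rewrite -(prim_order_dvd prZ).
Qed.

Lemma exp_char_mod a (i : 'I_N) m n : is_char a -> m = n %[mod d i] ->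
  Z ^+ (a i * m) = Z ^+ (a i * n).
Proof.
move/is_charP=> aP mn.
have red k : Z ^+ (a i * k) = Z ^+ (a i * (k %% d i)).
  rewrite {1}(divn_eq k (d i)) mulnDr exprD (mulnC (k %/ d i)%N).
  by rewrite mulnA (mulnC (a i)) exprM aP expr1n mul1r.
by rewrite red mn -red.
Qed.

Lemma chr_mul a g h : is_char a -> chr a (g * h)%g = chr a g * chr a h.
Proof.
move=> aP; rewrite -big_split; apply: eq_bigr => i _ /=.
by rewrite -exprD -mulnDr; apply: exp_char_mod aP _; apply: (coord_mul cG).
Qed.

Lemma chr1 a : is_char a -> chr a 1%g = 1.
Proof.
move=> aP; apply: big1 => i _.
by rewrite (exp_char_mod aP (coord1 cG i)) muln0 expr0.
Qed.

Lemma chr_gen a j : is_char a -> chr a (x j) = Z ^+ a j.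
Proof.
move=> aP; rewrite /chr (bigD1 j) //= (exp_char_mod aP (coord_gen cG j j)).
rewrite eqxx muln1 big1 ?mulr1 // => i /negPf ij.
by rewrite (exp_char_mod aP (coord_gen cG i j)) ij muln0 expr0.
Qed.

Lemma chr_order a g : chr a g ^+ E.+1 = 1.
Proof.
rewrite -prodrXl; apply: big1 => i _.
by rewrite -exprM mulnC exprM (prim_expr_order prZ) expr1n.
Qed.

Lemma chr_exists (chi : gT -> L) :
  chi 1%g = 1 -> (forall g h, chi (g * h)%g = chi g * chi h) ->
  exists2 a, is_char a & chi =1 chr a.
Proof.
move=> chi1 chiM.
have chiX g n : chi (g ^+ n)%g = chi g ^+ n.
  by elim: n => [|n IHn]; rewrite ?expg0 // expgS chiM IHn exprS.
have chid i : chi (x i) ^+ d i = 1 by rewrite -chiX (coord_expg cG).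
have chiE i : chi (x i) ^+ E.+1 = 1.
  by rewrite -(divnK (d_dvd i)) mulnC exprM chid expr1n.
pose a : {ffun 'I_N -> 'I_E.+1} := [ffun i => sval (prim_rootP prZ (chiE i))].
have aE i : Z ^+ a i = chi (x i) by rewrite ffunE; case: prim_rootP.
exists a; first by apply/is_charP => i; rewrite mulnC exprM aE chid.
move=> g; rewrite (morph_coord cG chi1 chiM); apply: eq_bigr => i _.
by rewrite exprM aE.
Qed.

Lemma chr_inj a b : is_char a -> is_char b -> chr a =1 chr b -> a = b.
Proof.
move=> aP bP ab; apply/ffunP => i; apply: val_inj => /=.
have := ab (x i); rewrite !chr_gen // => /eqP.
by rewrite (eq_prim_root_expr prZ) !modn_small // => /eqP.
Qed.

Lemma extB a u v : ext a (u - v) = ext a u - ext a v.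
Proof.
rewrite /ext -sumrB; apply: eq_bigr => g _.
by rewrite !ffunE rmorphB mulrBl.
Qed.

Lemma extD a u v : ext a (u + v) = ext a u + ext a v.
Proof.
rewrite /ext -big_split; apply: eq_bigr => g _.
by rewrite ffunE rmorphD mulrDl.
Qed.

Lemma ext0 a : ext a 0 = 0.
Proof. by rewrite -(subrr 0) extB subrr. Qed.

Lemma ext_scale a t u : ext a (galg_scale t u) = f t * ext a u.
Proof.
rewrite /ext mulr_sumr; apply: eq_bigr => g _.
by rewrite ffunE rmorphM mulrA.
Qed.

Lemma ext_elt a g : ext a (galg_elt F g) = chr a g.
Proof.
rewrite /ext (bigD1 g) //= ffunE eqxx rmorph1 mul1r big1 ?addr0 // => h /negPf gh.
by rewrite ffunE gh rmorph0 mul0r.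
Qed.

Lemma ext_tmul a u v : is_char a ->
  ext a (tmul trivial_cocycle u v) = ext a u * ext a v.
Proof.
move=> aP; rewrite /ext mulr_suml.
transitivity (\sum_y \sum_g \sum_(h | (g * h)%g == y) (f (u g) * chr a g) * (f (v h) * chr a h)).
  apply: eq_bigr => y _; rewrite ffunE rmorph_sum mulr_suml; apply: eq_bigr => g _.
  rewrite rmorph_sum mulr_suml; apply: eq_bigr => h /eqP <-.
  by rewrite !rmorphM rmorph1 mulr1 chr_mul // mulrACA.
rewrite exchange_big; apply: eq_bigr => g _ /=; rewrite mulr_sumr.
rewrite (exchange_big_dep predT) //=; apply: eq_bigr => h _.
by rewrite (big_pred1 (g * h)%g) // => y; rewrite eq_sym.
Qed.

Lemma ext_tone a : is_char a -> ext a (tone trivial_cocycle) = 1.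
Proof.
move=> aP; rewrite -(chr1 aP) -ext_elt; congr ext; apply/ffunP => g.
by rewrite !ffunE invr1; case: eqP.
Qed.

(** Some character [b] differs from 1 at [g]; translation by [b] permutes the characters and
    multiplies the sum by [chr b g]. *)
Lemma sum_chr_eq0 g : g != 1%g -> \sum_(a | is_char a) chr a g = 0.
Proof.
move=> g_neq1.
have [i ndvd] : exists i : 'I_N, ~~ (d i %| c i g)%N.
  apply/existsP; apply: contraNT g_neq1 => /existsPn dvd; apply/eqP.
  apply: (coord_inj cG) => i; rewrite (coord1 cG) mod0n; apply/eqP.
  by have := dvd i; rewrite negbK.
have lt_i : (E.+1 %/ d i %% E.+1 < E.+1)%N by rewrite ltn_mod.
(* [b] sends [x i] to a root of unity of order [d i] and the other generators to 1. Addition in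
   ['I_E.+1] is modulo [E.+1], so [a + b] encodes a product of characters. *)
pose b : {ffun 'I_N -> 'I_E.+1} := [ffun j => if j == i then Ordinal lt_i else ord0].
have Zb j : Z ^+ b j = if j == i then Z ^+ (E.+1 %/ d i) else 1.
  by rewrite ffunE; case: eqP => //= _; rewrite (prim_expr_mod prZ).
have bP : is_char b.
  apply/is_charP => j; rewrite mulnC exprM Zb; case: eqP => [->|_]; rewrite ?expr1n //.
  by rewrite -exprM divnK // (prim_expr_order prZ).
have b_neq1 : chr b g != 1.
  rewrite /chr (bigD1 i) //= big1 ?mulr1; last first.
    by move=> j /negPf ji; rewrite exprM Zb ji expr1n.
  rewrite exprM Zb eqxx -exprM -(prim_order_dvd prZ).
  rewrite -{1}(divnK (d_dvd i)) dvdn_pmul2l // divn_gt0 ?(coord_gt0 cG) //.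
  exact: dvdn_leq.
have chrD a : chr (a + b) g = chr a g * chr b g.
  rewrite -big_split; apply: eq_bigr => j _ /=; rewrite ffunE -exprD -mulnDl.
  by rewrite !exprM /= (prim_expr_mod prZ).
have is_charD a : is_char (a + b) = is_char a.
  apply/is_charP/is_charP => aP j; have := aP j; rewrite ffunE !(mulnC (d j)) !exprM.
    rewrite /= (prim_expr_mod prZ) exprD exprMn -(exprM _ (b j)) (mulnC (b j)).
    by rewrite (is_charP _ bP) mulr1.
  rewrite /= (prim_expr_mod prZ) exprD exprMn -(exprM _ (b j)) (mulnC (b j)).
  by rewrite (is_charP _ bP) mulr1.
apply/eqP; rewrite -(mulIr_eq0 _ (mulIf (_ : chr b g - 1 != 0))) ?subr_eq0 //.
rewrite mulrBr mulr1 subr_eq0 mulr_suml; apply/eqP.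
rewrite [RHS](reindex_inj (addIr b)) /=.
by apply: eq_big => a; rewrite ?is_charD.
Qed.

(** Fourier inversion: by orthogonality the sum of the [ext a u * chr a g^-1] is [f (u g)] times the
    number of characters, which is nonzero in characteristic 0. *)
Lemma ext_inj u : [pchar L] =i pred0 -> (forall a, is_char a -> ext a u = 0) -> u = 0.
Proof.
move=> charL u0; apply/ffunP => g; rewrite ffunE; apply: (fmorph_inj f).
have : \sum_(a | is_char a) ext a u * chr a g^-1%g = 0.
  by apply: big1 => a aP; rewrite u0 // mul0r.
rewrite (eq_bigr (fun a => \sum_h f (u h) * chr a (h * g^-1)%g)); last first.
  move=> a aP; rewrite mulr_suml; apply: eq_bigr => h _.
  by rewrite chr_mul // mulrA.
rewrite exchange_big (bigD1 g) //= [X in _ + X]big1 ?addr0; last first.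
  move=> h hg; rewrite -mulr_sumr sum_chr_eq0 ?mulr0 //.
  by apply: contra hg; rewrite -eq_mulgV1.
rewrite mulgV -mulr_sumr (eq_bigr (fun=> 1)) => [|a aP]; last exact: chr1.
move/eqP; rewrite sumr_const mulf_eq0 (pcharf0P _).1 // => /orP[/eqP-> //|/eqP].
  by rewrite rmorph0.
move/card0_eq/(_ 0); rewrite inE => /negP[]; apply/is_charP => i.
by rewrite ffunE muln0 expr0.
Qed.

Lemma in_imageD a y z : in_image a y -> in_image a z -> in_image a (y + z).
Proof. by move=> [u <-] [v <-]; exists (u + v); apply: extD. Qed.

Lemma in_imageM a y z : is_char a -> in_image a y -> in_image a z -> in_image a (y * z).
Proof. by move=> aP [u <-] [v <-]; exists (tmul trivial_cocycle u v); apply: ext_tmul. Qed.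

Lemma in_imageX a y n : is_char a -> in_image a y -> in_image a (y ^+ n).
Proof.
move=> aP yP; elim: n => [|n IHn]; first by exists (tone trivial_cocycle); apply: ext_tone.
by rewrite exprS; apply: in_imageM.
Qed.

Lemma in_image_scale a t y : in_image a y -> in_image a (f t * y).
Proof. by move=> [u <-]; exists (galg_scale t u); apply: ext_scale. Qed.

Lemma in_image0 a : in_image a 0.
Proof. by exists 0; apply: ext0. Qed.

Lemma in_image_horner a (p : {poly F}) y : is_char a -> in_image a y ->
  in_image a (map_poly f p).[y].
Proof.
move=> aP yP; rewrite horner_coef; elim/big_ind: _ => [||i _].
- exact: in_image0.
- exact: in_imageD.
by rewrite coef_map; apply: in_image_scale; apply: in_imageX.
Qed.

Lemma ext_algebraic a u : algebraicOver f (ext a u).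
Proof.
rewrite /ext; elim/big_ind: _ => [||g _]; [exact: algebraic0|exact: algebraic_add|].
apply: algebraic_mul; first exact: algebraic_id.
exists ('X^(E.+1) - 1%:P); first by rewrite -size_poly_gt0 size_XnsubC.
apply/rootP; rewrite rmorphB /= map_polyXn map_polyC !hornerE /= rmorph1.
by rewrite chr_order subrr.
Qed.

(** The value [y] of [ext a u] is algebraic over F. Dividing an annihilator by a power of ['X] makes
    its constant term nonzero, and then [y ^-1] is a polynomial in [y]. *)
Lemma ext_unit a u : is_char a -> ext a u != 0 ->
  exists v, ext a (tmul trivial_cocycle u v) = 1.
Proof.
move=> aP; set y := ext a u => y_neq0.
have [p p_neq0 rp] := ext_algebraic a u.
have [m [q]] := multiplicity_XsubC p 0; rewrite p_neq0 /= => q0 def_p.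
have rq : (map_poly f q).[y] = 0.
  move: rp; rewrite def_p rmorphM rmorphXn /= map_polyXsubC rmorph0 rootM.
  case/orP=> [/rootP //|].
  by rewrite rootE horner_exp hornerXsubC subr0 expf_eq0 (negPf y_neq0) andbF.
have /factor_theorem[r def_q] : root (q - q.[0]%:P) 0.
  by rewrite rootE !hornerE subrr.
have def_fq : (map_poly f r).[y] * y = - f q.[0].
  have def_q' : r * 'X + q.[0]%:P = q by rewrite -(subr0 'X) -polyC0 -def_q subrK.
  have : (map_poly f (r * 'X + q.[0]%:P)).[y] = 0 by rewrite def_q'.
  rewrite rmorphD rmorphM /= map_polyX map_polyC hornerD hornerMX hornerC => /eqP.
  by rewrite addr_eq0 => /eqP.
have yP : in_image a y by exists u.
have [v def_v] := in_image_scale (- q.[0]^-1) (in_image_horner r aP yP).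
exists v; rewrite ext_tmul // def_v mulrC -mulrA def_fq rmorphN mulrNN -rmorphM.
by rewrite mulVf ?rmorph1.
Qed.

End Characters.

(** * Matching characters through a ring isomorphism of group algebras *)

Section Transfer.

Variables (F L : fieldType) (f : {rmorphism F -> L}).
Hypothesis charL : [pchar L] =i pred0.
Variables (gT hT : finGroupType) (N : nat) (d e : nat -> nat).
Variables (x : 'I_N -> gT) (c : 'I_N -> gT -> nat).
Variables (y : 'I_N -> hT) (k : 'I_N -> hT -> nat).
Hypotheses (cG : coordinates d x c) (cH : coordinates e y k).
Variables (E : nat) (Z : L).
Hypothesis prZ : E.+1.-primitive_root Z.
Hypotheses (d_dvd : forall i, (d i %| E.+1)%N) (e_dvd : forall i, (e i %| E.+1)%N).
Variable phi : {ffun gT -> F} -> {ffun hT -> F}.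
Hypotheses (phi_bij : bijective phi) (phiD : forall u v, phi (u + v) = phi u + phi v).
Hypothesis phiM : forall u v,
  phi (tmul trivial_cocycle u v) = tmul trivial_cocycle (phi u) (phi v).
Hypothesis phi1 : phi (tone trivial_cocycle) = tone trivial_cocycle.

Local Notation char := {ffun 'I_N -> 'I_E.+1}.
Local Notation extG := (ext f c Z).
Local Notation extH := (ext f k Z).
Local Notation is_charG := (@is_char N d E).
Local Notation is_charH := (@is_char N e E).
Local Notation "u *_t v" := (tmul trivial_cocycle u v) (at level 40).

(** [phi] need not commute with scalars, so [extH b \o phi] need not be the extension of a
    character; its kernel still makes sense. *)
Definition related (a b : char) := forall u, extG a u = 0 <-> extH b (phi u) = 0.

Let phi0 : phi 0 = 0.
Proof. by apply: (addrI (phi 0)); rewrite -phiD !addr0. Qed.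

Let phiB u v : phi (u - v) = phi u - phi v.
Proof. by apply: (addIr (phi v)); rewrite -phiD !subrK. Qed.

Let phi_surj v : exists u, phi u = v.
Proof. by case: phi_bij => psi _ psiK; exists (psi v). Qed.

(* The kernel of [extG a], carried to the algebra of [hT], is prime and contains the
   intersection of the kernels of all [extH b], which is [0]; so it contains one of
   these kernels, and these are maximal. *)
Lemma related_exists a : is_charG a -> exists2 b, is_charH b & related a b.
Proof.
move=> aP.
have [b bP sub_ba] : exists2 b, is_charH b & forall u, extH b (phi u) = 0 -> extG a u = 0.
  apply: contrapT => noB.
  have witness b : is_charH b -> exists2 u, extH b (phi u) = 0 & extG a u != 0.
    move=> bP; apply: contrapT => noU; apply: noB; exists b => // u bu.
    by apply/eqP; apply: contrapT => /negP au; apply: noU; exists u.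
  have [u au bu] : exists2 u, extG a u != 0 &
      forall b, b \in enum is_charH -> extH b (phi u) = 0.
    have : {subset enum is_charH <= is_charH} by move=> b; rewrite mem_enum.
    elim: (enum _) => [|b s IHs] sP.
      by exists (tone trivial_cocycle) => //; rewrite (ext_tone f cG prZ) // oner_eq0.
    have bP : is_charH b := sP b (mem_head b s).
    have [u au us] := IHs (fun b' b's => sP b' (mem_behead (s := b :: s) b's)).
    have [v bv av] := witness b bP.
    exists (u *_t v); first by rewrite (ext_tmul f cG prZ) // mulf_neq0.
    move=> b'; rewrite inE => /predU1P[->|b's]; rewrite phiM.
      by rewrite (ext_tmul f cH prZ) // bv mulr0.
    have b'P : is_charH b' by apply: sP; rewrite inE b's orbT.
    by rewrite (ext_tmul f cH prZ) // us // mul0r.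
  have phiu0 : phi u = 0.
    by apply: (ext_inj cH prZ e_dvd charL) => b bP; apply: bu; rewrite mem_enum.
  by case/eqP: au; rewrite (_ : u = 0) ?ext0 //; apply: (bij_inj phi_bij); rewrite phi0.
exists b => // u; split=> [au|]; last exact: sub_ba.
apply/eqP; apply: contraT => bu_neq0.
have [v buv] := ext_unit cH prZ bP bu_neq0.
have [w def_v] := phi_surj v.
have : extG a (u *_t w - tone trivial_cocycle) = 0.
  apply: sub_ba; rewrite phiB phiM phi1 def_v extB buv (ext_tone f cH prZ) //.
  by rewrite subrr.
rewrite extB (ext_tmul f cG prZ) // au mul0r (ext_tone f cG prZ) // sub0r => /eqP.
by rewrite oppr_eq0 oner_eq0.
Qed.

(** The elements [u_g ^ n - 1] and their images under [phi] lie in matching kernels, so [t] and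
    [chr c Z a g] are roots of unity of the same order, and each is a power of the other. *)
Lemma related_in_image a b g : is_charG a -> is_charH b -> related a b ->
  in_image f k Z b (chr c Z a g).
Proof.
move=> aP bP ab; pose t := extH b (phi (galg_elt F g)).
have pow_elt n : exists2 u, extG a u = chr c Z a g ^+ n & extH b (phi u) = t ^+ n.
  elim: n => [|n [u au bu]].
    exists (tone trivial_cocycle); rewrite ?phi1 ?(ext_tone f cG prZ) //.
    by rewrite (ext_tone f cH prZ).
  exists (galg_elt F g *_t u); first by rewrite (ext_tmul f cG prZ) // ext_elt au exprS.
  by rewrite phiM (ext_tmul f cH prZ) // bu exprS.
have pow1 n : chr c Z a g ^+ n = 1 <-> t ^+ n = 1.
  have [u au bu] := pow_elt n; have := ab (u - tone trivial_cocycle).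
  rewrite phiB phi1 !extB (ext_tone f cH prZ) // (ext_tone f cG prZ) // au bu.
  by split=> [/eqP|/eqP]; rewrite -subr_eq0 => /eqP /H /eqP; rewrite subr_eq0 => /eqP.
have tE : t ^+ E.+1 = 1 by apply/pow1; apply: chr_order.
have [m prt _] := prim_order_exists (ltn0Sn E) tE.
have [i ->] := prim_rootP prt ((pow1 m).2 (prim_expr_order prt)).
by apply: (in_imageX cH prZ) => //; exists (phi (galg_elt F g)).
Qed.

(* Write [chr a0 g] as [extH b0 (w g)]; a [b] with the same kernel as [b0] then yields
   the character [g |-> extH b (w g)], which has the same kernel as [a0]. *)
Lemma card_related_le a0 b0 : is_charG a0 -> is_charH b0 -> related a0 b0 ->
  (forall h, in_image f c Z a0 (chr k Z b0 h)) ->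
  (#|[pred b | is_charH b && `[< related a0 b >]]| <=
   #|[pred a | is_charG a && `[< related a b0 >]]|)%N.
Proof.
move=> a0P b0P ab0 im_b0.
have [w wP] := choice (fun g => related_in_image g a0P b0P ab0).
pose sumw (u : {ffun gT -> F}) := \sum_g galg_scale (u g) (w g).
have ext_sumw b u : extH b (sumw u) = \sum_g f (u g) * extH b (w g).
  rewrite /sumw; elim/big_rec2: _ => [|g s v _ <-]; first exact: ext0.
  by rewrite extD ext_scale.
have sumw0 u : extH b0 (sumw u) = extG a0 u.
  by rewrite ext_sumw; apply: eq_bigr => g _; rewrite wP.
have ker_eq b v : related a0 b -> extH b v = 0 <-> extH b0 v = 0.
  by move=> ab; have [u <-] := phi_surj v; rewrite -(ab u) -(ab0 u).
have eq_ext b v v' : related a0 b -> extH b0 v = extH b0 v' -> extH b v = extH b v'.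
  move=> ab vv'; apply/eqP; rewrite -subr_eq0 -extB; apply/eqP/(ker_eq _ _ ab).
  by rewrite extB vv' subrr.
have exT b : exists a, is_charH b /\ related a0 b ->
    [/\ is_charG a, related a b0 & forall u, extG a u = extH b (sumw u)].
  have [[bP ab]|nab] := pselect (is_charH b /\ related a0 b); last first.
    by exists a0.
  have [||a aP def_a] := chr_exists cG prZ d_dvd (chi := fun g => extH b (w g)).
  - rewrite -(ext_tone f cH prZ bP); apply: eq_ext => //.
    by rewrite wP (chr1 cG prZ) // (ext_tone f cH prZ).
  - move=> g h; rewrite -(ext_tmul f cH prZ) //; apply: eq_ext => //.
    by rewrite (ext_tmul f cH prZ) // !wP (chr_mul cG prZ).
  have extT u : extG a u = extH b (sumw u).
    by rewrite ext_sumw; apply: eq_bigr => g _; rewrite def_a.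
  exists a => _; split=> // u.
  by rewrite extT (ker_eq _ _ ab) sumw0; apply: ab0.
have [T TP] := choice exT.
have TPb b : b \in [pred b | is_charH b && `[< related a0 b >]] ->
    is_charH b /\ related a0 b.
  by rewrite inE => /andP[? /asboolP].
rewrite -(card_in_image (f := T)); last first.
  move=> b b' /TPb[bP ab] /TPb[b'P ab'] Tbb'.
  apply: (chr_inj cH prZ) => // h.
  (* Injectivity: [chr k Z b0 h] is a value of [extG a0], hence of [extH b0 \o sumw]. Equality of
     kernels carries this identity to every related [b], so [T b] determines [chr k Z b h]. *)
  have [v def_v] := im_b0 h.
  have chrE b1 : is_charH b1 -> related a0 b1 -> chr k Z b1 h = extG (T b1) v.
    move=> b1P ab1; have [_ _ ->] := TP b1 (conj b1P ab1).
    by rewrite -(ext_elt f); apply: eq_ext; rewrite // ext_elt sumw0.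
  by rewrite !chrE // Tbb'.
apply/subset_leq_card/subsetP => _ /imageP[b /TPb[bP ab] ->].
have [TbP Tb_rel _] := TP b (conj bP ab).
by rewrite inE TbP; apply/asboolP.
Qed.

End Transfer.

(** * Counting characters with values in an intermediate field *)

Lemma related_in_image_all (F L : fieldType) (f : {rmorphism F -> L})
    (gT : finGroupType) (N E : nat) (c : 'I_N -> gT -> nat) (Z : L)
    (a : {ffun 'I_N -> 'I_E.+1}) (M : L -> Prop) y :
  M 0 -> (forall u v, M u -> M v -> M (u + v)) -> (forall t u, M u -> M (f t * u)) ->
  (forall g, M (chr c Z a g)) -> in_image f c Z a y -> M y.
Proof.
move=> M0 MD MZ Ma [u <-]; rewrite /ext; elim/big_ind: _ => // g _.
exact: MZ.
Qed.

(** The exponents [n] with [Z ^+ n] in [M] are the multiples of the least positive one, [m]; then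
    [w] is the number of [E.+1]-th roots of unity in [M]. *)
Lemma exponents_multiples (L : fieldType) (E : nat) (Z : L) (M : L -> Prop) :
  E.+1.-primitive_root Z -> M 1 -> (forall u v, M u -> M v -> M (u * v)) ->
  exists m w, [/\ E.+1 = (m * w)%N, (0 < m)%N, (0 < w)%N &
    forall n, M (Z ^+ n) <-> (m %| n)%N].
Proof.
move=> prZ M1 MM.
pose P n := `[< M (Z ^+ n) >] && (0 < n)%N.
have exP : exists n, P n.
  by exists E.+1; rewrite /P andbT; apply/asboolP; rewrite (prim_expr_order prZ).
have [m /andP[/asboolP Mm m_gt0] m_min] := ex_minnP exP.
have MX u n : M u -> M (u ^+ n).
  by move=> Mu; elim: n => [|n IHn]; rewrite ?expr0 // exprS; apply: MM.
have Mdvd n : M (Z ^+ n) <-> (m %| n)%N.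
  split=> [Mn|/dvdnP[q ->]]; last by rewrite mulnC exprM; apply: MX.
  have Mr : M (Z ^+ (n %% m)).
    (* [M] is closed under products only, so the exponent [E * (n %/ m)] replaces [- (n %/ m)], as
       [Z] has order [E.+1]. *)
    have -> : Z ^+ (n %% m) = Z ^+ n * (Z ^+ m) ^+ (E * (n %/ m)).
      rewrite -exprM -exprD mulnCA {2}(divn_eq n m) addnAC (mulnC _ m) -mulSn.
      by rewrite exprD exprM (prim_expr_order prZ) expr1n mul1r.
    by apply: (MM) => //; apply: MX.
  rewrite /dvdn; apply: contraT; rewrite -lt0n => r_gt0.
  have := m_min (n %% m)%N; rewrite /P r_gt0 andbT => /(_ (introT (asboolP _) Mr)).
  by rewrite leqNgt ltn_mod m_gt0.
have /dvdnP[w def_E] : (m %| E.+1)%N by apply/Mdvd; rewrite (prim_expr_order prZ).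
exists m, w; split=> //; first by rewrite mulnC.
by case: w def_E.
Qed.

Lemma card_chars_in (L : fieldType) (gT : finGroupType) (N : nat) (d : nat -> nat)
    (x : 'I_N -> gT) (c : 'I_N -> gT -> nat) (E m w : nat) (Z : L) (M : L -> Prop) :
  coordinates d x c -> E.+1.-primitive_root Z ->
  M 1 -> (forall u v, M u -> M v -> M (u * v)) ->
  E.+1 = (m * w)%N -> (0 < m)%N -> (0 < w)%N ->
  (forall n, M (Z ^+ n) <-> (m %| n)%N) ->
  #|[pred a : {ffun 'I_N -> 'I_E.+1} | is_char d a && `[< forall g, M (chr c Z a g) >]]| =
  (\prod_(i < N) gcdn w (d i))%N.
Proof.
move=> cG prZ M1 MM def_E m_gt0 w_gt0 MP.
have card_w n e : n = (m * w)%N ->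
    #|[pred a : 'I_n | (n %| e * a) && (m %| a)]%N| = gcdn w e.
  by move=> ->; apply: card_ord_dvd_mul_multiples.
pose Q (i : 'I_N) := [pred a : 'I_E.+1 | (E.+1 %| d i * a) && (m %| a)]%N.
rewrite (eq_card (B := family Q)) => [|a].
  rewrite card_family foldrE big_map big_enum /=; apply: eq_bigr => i _.
  exact: card_w.
rewrite inE; apply/andP/familyP => [[aP /asboolP Ma] i|aQ].
  rewrite inE (forallP aP) /=; apply/MP.
  by rewrite -(chr_gen cG prZ).
have aP : is_char d a by apply/forallP => i; have := aQ i; rewrite inE => /andP[].
split=> //; apply/asboolP => g; apply: big_ind => // i _.
rewrite mulnC exprM; have {aQ} := aQ i; rewrite inE => /andP[_ /MP Mi].
rewrite -exprM mulnC exprM; elim: (c i g) => [|n IHn]; rewrite ?expr0 // exprS.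
exact: MM.
Qed.

Section CharacterCount.

Variables (F L : fieldType) (f : {rmorphism F -> L}).
Hypothesis charL : [pchar L] =i pred0.
Variables (gT hT : finGroupType) (N : nat) (d e : nat -> nat).
Variables (x : 'I_N -> gT) (c : 'I_N -> gT -> nat).
Variables (y : 'I_N -> hT) (k : 'I_N -> hT -> nat).
Hypotheses (cG : coordinates d x c) (cH : coordinates e y k).
Variables (E : nat) (Z : L).
Hypothesis prZ : E.+1.-primitive_root Z.
Hypotheses (d_dvd : forall i, (d i %| E.+1)%N) (e_dvd : forall i, (e i %| E.+1)%N).
Hypothesis iso : twisted_ring_iso (@trivial_cocycle F gT) (@trivial_cocycle F hT).

(** Related characters generate the same field over F, so an F-subspace [M] of L contains all values
    of both or of neither. The matching is many-to-many, hence the comparison class by class. *)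
Lemma card_chars_eq (M : L -> Prop) :
  M 0 -> (forall u v, M u -> M v -> M (u + v)) -> (forall t u, M u -> M (f t * u)) ->
  #|[pred a : {ffun 'I_N -> 'I_E.+1} | is_char d a && `[< forall g, M (chr c Z a g) >]]| =
  #|[pred b : {ffun 'I_N -> 'I_E.+1} | is_char e b && `[< forall h, M (chr k Z b h) >]]|.
Proof.
move=> M0 MD MZ.
have [phi [[psi phiK psiK] [phiD [phiM phi1]]]] := iso.
have phi_bij : bijective phi by exists psi.
have psi_bij : bijective psi by exists phi.
have psiD u v : psi (u + v) = psi u + psi v.
  by apply: (can_inj phiK); rewrite phiD !psiK.
have psiM u v : psi (tmul trivial_cocycle u v) = tmul trivial_cocycle (psi u) (psi v).
  by apply: (can_inj phiK); rewrite phiM !psiK.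
have psi1 : psi (tone trivial_cocycle) = tone trivial_cocycle.
  by apply: (can_inj phiK); rewrite phi1 psiK.
have rel_sym (a b : {ffun 'I_N -> 'I_E.+1}) : related f c k Z phi a b <-> related f k c Z psi b a.
  by split=> ab v; [have := ab (psi v) | have := ab (phi v)];
    rewrite ?psiK ?phiK => [[? ?]]; split.
have imH (a b : {ffun 'I_N -> 'I_E.+1}) h : is_char d a -> is_char e b -> related f c k Z phi a b ->
    in_image f c Z a (chr k Z b h).
  move=> aP bP ab; have ba := (rel_sym a b).1 ab.
  exact: (related_in_image cH cG prZ psiD psiM psi1 h bP aP ba).
have imG (a b : {ffun 'I_N -> 'I_E.+1}) g : is_char d a -> is_char e b -> related f c k Z phi a b ->
    in_image f k Z b (chr c Z a g).
  exact: (related_in_image cG cH prZ phiD phiM phi1).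
have MG (a b : {ffun 'I_N -> 'I_E.+1}) : is_char d a -> is_char e b -> related f c k Z phi a b ->
    (forall g, M (chr c Z a g)) -> forall h, M (chr k Z b h).
  by move=> aP bP ab Ma h; apply: related_in_image_all Ma (imH _ _ h aP bP ab).
have MH (a b : {ffun 'I_N -> 'I_E.+1}) : is_char d a -> is_char e b -> related f c k Z phi a b ->
    (forall h, M (chr k Z b h)) -> forall g, M (chr c Z a g).
  by move=> aP bP ab Mb g; apply: related_in_image_all Mb (imG _ _ g aP bP ab).
apply: (card_eq_of_classes (r := fun a b => `[< related f c k Z phi a b >])).
- move=> a /andP[aP /asboolP Ma].
  have [b bP ab] := related_exists f charL cG cH prZ e_dvd phi_bij phiD phiM phi1 aP.
  exists b; last exact/asboolP.
  by apply/andP; split=> //; apply/asboolP; apply: MG ab Ma.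
- move=> b /andP[bP /asboolP Mb].
  have [a aP ba] := related_exists f charL cH cG prZ d_dvd psi_bij psiD psiM psi1 bP.
  have ab := (rel_sym a b).2 ba.
  exists a; last exact/asboolP.
  by apply/andP; split=> //; apply/asboolP; apply: MH ab Mb.
move=> a b /andP[aP /asboolP Ma] /andP[bP /asboolP Mb] /asboolP ab.
rewrite (eq_card (B := [pred b' | is_char e b' && `[< related f c k Z phi a b' >]])); last first.
  move=> b'; rewrite !inE -andbA; apply: andb_id2l => b'P.
  by apply/andb_idl => /asboolP ab'; apply/asboolP; apply: MG ab' Ma.
rewrite [RHS](eq_card (B := [pred a' |
    is_char d a' && `[< related f c k Z phi a' b >]])); last first.
  move=> a'; rewrite !inE -andbA; apply: andb_id2l => a'P.
  by apply/andb_idl => /asboolP a'b; apply/asboolP; apply: MH a'b Mb.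
(* One inequality comes from [phi], the other from its inverse with the two groups exchanged. *)
apply/eqP; rewrite eqn_leq; apply/andP; split.
  apply: (card_related_le cG cH prZ d_dvd phi_bij phiD phiM phi1) => // h.
  exact: imH.
rewrite (eq_card (B := [pred a' | is_char d a' && `[< related f k c Z psi b a' >]])); last first.
  by move=> a'; rewrite !inE; congr andb; apply/asboolP/asboolP => /rel_sym.
rewrite [X in (_ <= X)%N](eq_card (B := [pred b' |
    is_char e b' && `[< related f k c Z psi b' a >]])); last first.
  by move=> a'; rewrite !inE; congr andb; apply/asboolP/asboolP => /rel_sym.
apply: (card_related_le cH cG prZ e_dvd psi_bij psiD psiM psi1) => //.
- exact/rel_sym.
by move=> g; apply: imG.
Qed.

Lemma prod_gcdn_eq (M : L -> Prop) :
  M 0 -> M 1 -> (forall u v, M u -> M v -> M (u + v)) ->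
  (forall u v, M u -> M v -> M (u * v)) -> (forall t, M (f t)) ->
  exists m w, [/\ E.+1 = (m * w)%N, (0 < m)%N, (0 < w)%N,
    forall n, M (Z ^+ n) <-> (m %| n)%N &
    (\prod_(i < N) gcdn w (d i) = \prod_(i < N) gcdn w (e i))%N].
Proof.
move=> M0 M1 MD MM Mf.
have [m [w [def_E m_gt0 w_gt0 MP]]] := exponents_multiples prZ M1 MM.
exists m, w; split=> //.
rewrite -(card_chars_in cG prZ M1 MM def_E) // -(card_chars_in cH prZ M1 MM def_E) //.
by apply: card_chars_eq => // t u Mu; apply: MM.
Qed.

End CharacterCount.

(** * Valuations of the elementary divisors *)

(** By monotonicity the indices with [t < v i] and those with [t < v' i] form two initial segments,
    one inside the other. If [j] belonged to just one of them, its positive weight would make the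
    sums differ. *)
Lemma eq_threshold N (W v v' : nat -> nat) t j :
  {homo v : i j / (i <= j)%N >-> (j <= i)%N} ->
  {homo v' : i j / (i <= j)%N >-> (j <= i)%N} ->
  (\sum_(i < N) W i * (t < v i) = \sum_(i < N) W i * (t < v' i))%N ->
  (j < N)%N -> (0 < W j)%N -> (t < v j)%N = (t < v' j)%N.
Proof.
wlog suff main : v v' / {homo v : i j / (i <= j)%N >-> (j <= i)%N} ->
    {homo v' : i j / (i <= j)%N >-> (j <= i)%N} ->
    (\sum_(i < N) W i * (t < v i) = \sum_(i < N) W i * (t < v' i))%N ->
    (j < N)%N -> (0 < W j)%N -> (t < v j)%N -> (t < v' j)%N.
  move=> mon_v mon_v' eq_vv' jN Wj; apply/idP/idP; first exact: main.
  by apply: main.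
move=> mon_v mon_v' eq_vv' jN Wj tj; apply: contraT; rewrite -leqNgt => jt.
move: eq_vv'; rewrite (bigD1 (Ordinal jN)) //= [in RHS](bigD1 (Ordinal jN)) //=.
rewrite tj ltnNge jt muln0 muln1 add0n => eq_sum.
have : (\sum_(i < N | i != Ordinal jN) W i * (t < v' i) <=
        \sum_(i < N | i != Ordinal jN) W i * (t < v i))%N.
  apply: leq_sum => i _; rewrite leq_mul2l; apply/orP; right.
  have [ij|/ltnW ji] := leqP i j; first by rewrite (leq_trans tj (mon_v _ _ ij)) leq_b1.
  by rewrite [(t < v' i)%N]ltnNge (leq_trans (mon_v' _ _ ji) jt).
by rewrite -eq_sum -[X in (_ <= X)%N]add0n leq_add2r leqNgt Wj.
Qed.

Lemma minnSl m a : minn m.+1 a = (minn m a + (m < a))%N.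
Proof.
have [ma|am] := ltnP m a.
  by rewrite (minn_idPl ma) addn1.
by rewrite (minn_idPr (leqW am)) addn0.
Qed.

(** Differences of consecutive sums count the indices with [t < v i], plainly for [t >= k] and with
    weight [i] for [t < k]. The weight loses the index 0, whose truncated value is what remains of
    the plain sum at [k]. *)
Lemma eq_from_sums N (v v' : nat -> nat) k :
  {homo v : i j / (i <= j)%N >-> (j <= i)%N} ->
  {homo v' : i j / (i <= j)%N >-> (j <= i)%N} ->
  (forall m, (k <= m)%N -> \sum_(i < N) minn m (v i) = \sum_(i < N) minn m (v' i))%N ->
  (forall t, (t <= k)%N ->
     \sum_(i < N) i * minn t (v i) = \sum_(i < N) i * minn t (v' i))%N ->
  forall j, (j < N)%N -> v j = v' j.
Proof.
move=> mon_v mon_v' sumS sumU.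
have big_t t j : (k <= t)%N -> (j < N)%N -> (t < v j)%N = (t < v' j)%N.
  move=> kt jN; apply: (eq_threshold (N := N) (W := fun=> 1%N)) => //.
  have := sumS t.+1 (leqW kt).
  rewrite (eq_bigr (fun i : 'I_N => minn t (v i) + (t < v i)))%N; last first.
    by move=> i _; apply: minnSl.
  rewrite [RHS](eq_bigr (fun i : 'I_N => minn t (v' i) + (t < v' i)))%N; last first.
    by move=> i _; apply: minnSl.
  rewrite !big_split /= (sumS t kt) => /addnI eq_sum.
  by rewrite eq_sum.
have small_t t j : (t < k)%N -> (0 < j < N)%N -> (t < v j)%N = (t < v' j)%N.
  move=> tk /andP[j_gt0 jN]; apply: (eq_threshold (N := N) (W := fun i => i)) => //.
  have := sumU t.+1 tk.
  rewrite (eq_bigr (fun i : 'I_N => i * minn t (v i) + i * (t < v i)))%N; last first.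
    by move=> i _; rewrite minnSl mulnDr.
  rewrite [RHS](eq_bigr (fun i : 'I_N => i * minn t (v' i) + i * (t < v' i)))%N; last first.
    by move=> i _; rewrite minnSl mulnDr.
  by rewrite !big_split /= (sumU t (ltnW tk)) => /addnI.
have min_pos j : (0 < j < N)%N -> minn k (v j) = minn k (v' j).
  move=> jP; have vj t tk := small_t t j tk jP.
  have min_le a b : (forall t, (t < k -> t < a -> t < b)%N) -> (minn k a <= minn k b)%N.
    move=> ab; rewrite leq_min geq_minl /= leqNgt; apply/negP => b_lt.
    have [bk ba] : (b < k)%N /\ (b < a)%N by move: b_lt; rewrite leq_min => /andP[].
    by have := ab b bk ba; rewrite ltnn.
  by apply/eqP; rewrite eqn_leq !min_le // => t tk; rewrite vj.
have min_eq j : (j < N)%N -> minn k (v j) = minn k (v' j).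
  case: j => [|j] jN; last exact: min_pos.
  have := sumS k (leqnn k); rewrite (bigD1 (Ordinal jN)) //= [in RHS](bigD1 (Ordinal jN)) //=.
  rewrite (eq_bigr (fun i : 'I_N => minn k (v' i))); first exact: addIn.
  move=> i; rewrite -val_eqE -lt0n => i_gt0; apply: min_pos.
  by rewrite ltn_ord andbT.
move=> j jN; have no_lt a b : minn k a = minn k b ->
    (forall t, (k <= t)%N -> (t < a)%N = (t < b)%N) -> (b <= a)%N.
  move=> mab tab; rewrite leqNgt; apply/negP => ab.
  have [ka|ak] := leqP k a; first by have := tab a ka; rewrite ltnn ab.
  by move: mab; rewrite (minn_idPr (ltnW ak)) /minn; case: ltnP => _ eq_ab;
    rewrite -eq_ab ltnn in ak ab.
have min_j := min_eq j jN.
by apply/eqP; rewrite eqn_leq; apply/andP; split; apply: no_lt => // t kt; rewrite big_t.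
Qed.

Lemma logn_prod p (I : finType) (G : I -> nat) : (forall i, 0 < G i)%N ->
  logn p (\prod_i G i)%N = (\sum_i logn p (G i))%N.
Proof.
move=> G_gt0.
suff [] : (0 < \prod_i G i)%N /\ logn p (\prod_i G i)%N = (\sum_i logn p (G i))%N by [].
elim/big_rec2: _ => [|i s t _ [t_gt0 <-]]; first by rewrite logn1.
by rewrite muln_gt0 G_gt0 lognM.
Qed.

(** * Truncated valuations from character counts *)

Section PrimaryCounts.

Variables (F : fieldType) (L : closedFieldType) (f : {rmorphism F -> L}).
Hypothesis charL : [pchar L] =i pred0.
Variables (gT hT : finGroupType) (N : nat) (d e : nat -> nat).
Variables (x : 'I_N -> gT) (c : 'I_N -> gT -> nat).
Variables (y : 'I_N -> hT) (k : 'I_N -> hT -> nat).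
Hypotheses (cG : coordinates d x c) (cH : coordinates e y k).
Hypothesis iso : twisted_ring_iso (@trivial_cocycle F gT) (@trivial_cocycle F hT).

Let d_gt0 := coord_gt0 cG.
Let e_gt0 := coord_gt0 cH.

(** Taking all of L for [M] counts every character, so the two groups have the same order. *)
Lemma prod_orders_eq : (\prod_(i < N) d i = \prod_(i < N) e i)%N.
Proof.
have E_gt0 : (0 < d 0 * e 0)%N by rewrite muln_gt0 d_gt0 e_gt0.
have [Z prZ] := exists_prim_root charL E_gt0.
rewrite -(prednK E_gt0) in prZ.
have d_dvd i : (d i %| (d 0 * e 0).-1.+1)%N by rewrite prednK // dvdn_mulr // (coord_dvd cG).
have e_dvd i : (e i %| (d 0 * e 0).-1.+1)%N by rewrite prednK // dvdn_mull // (coord_dvd cH).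
have [|||||m [w [def_E m_gt0 w_gt0 mP]]] :=
  @prod_gcdn_eq _ _ f charL _ _ _ _ _ _ _ _ _ cG cH _ _ prZ d_dvd e_dvd iso (fun=> True);
  rewrite ?def_E //.
have m1 : m = 1%N by apply/eqP; rewrite -dvdn1; apply/mP.
rewrite m1 mul1n in def_E.
rewrite (eq_bigr (fun i : 'I_N => d i)) => [|i _]; last by apply/gcdn_idPr; rewrite -def_E.
by rewrite [RHS](eq_bigr (fun i : 'I_N => e i)) => // i _; apply/gcdn_idPr; rewrite -def_E.
Qed.

Lemma sum_minn_logn_eq p r : prime p ->
  (forall Z : L, (p ^ r.+1).-primitive_root Z -> ~ in_adj f (Z ^+ p) Z) ->
  (\sum_(i < N) minn r (logn p (d i)) = \sum_(i < N) minn r (logn p (e i)))%N.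
Proof.
(* [d 0 * e 0] is a common multiple of all the orders, and the factor [p ^ r.+1] provides roots of
   unity of that order. Below, [th] has order [p ^ r]. *)
move=> p_pr notadj; set E := (p ^ r.+1 * (d 0 * e 0))%N.
have E_gt0 : (0 < E)%N by rewrite !muln_gt0 d_gt0 e_gt0 expn_gt0 prime_gt0.
have [Z prZ] := exists_prim_root charL E_gt0.
have prZr : (p ^ r.+1).-primitive_root (Z ^+ (d 0 * e 0)).
  have := dvdn_prim_root prZ (dvdn_mulr (d 0 * e 0) (dvdnn (p ^ r.+1))).
  by rewrite mulKn // expn_gt0 prime_gt0.
set th := Z ^+ (d 0 * e 0 * p).
have th_notadj : ~ in_adj f th (Z ^+ (d 0 * e 0)) by rewrite /th exprM; apply: notadj.
rewrite -(prednK E_gt0) in prZ.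
have d_dvd i : (d i %| E.-1.+1)%N.
  by rewrite prednK // dvdn_mull // dvdn_mulr // (coord_dvd cG).
have e_dvd i : (e i %| E.-1.+1)%N.
  by rewrite prednK // dvdn_mull // dvdn_mull // (coord_dvd cH).
have [|||||m [w [def_E m_gt0 w_gt0 mP]]] :=
  @prod_gcdn_eq _ _ f charL _ _ _ _ _ _ _ _ _ cG cH _ _ prZ d_dvd e_dvd iso (in_adj f th).
- by exists 0; rewrite rmorph0 horner0.
- by exists 1; rewrite rmorph1 hornerC.
- by move=> _ _ [q ->] [s ->]; exists (q + s); rewrite rmorphD hornerD.
- by move=> _ _ [q ->] [s ->]; exists (q * s); rewrite rmorphM hornerM.
- by move=> t; exists t%:P; rewrite map_polyC hornerC.
have rw : logn p w = r.
  have th_in : (m %| d 0 * e 0 * p)%N by apply/mP; exists 'X; rewrite map_polyX hornerX.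
  have th_out : ~~ (m %| d 0 * e 0)%N by apply/negP => /mP.
  rewrite prednK // in def_E.
  (* [Z ^+ (d 0 * e 0 * p ^ (r.+1 - s))] has order [p ^ s], so [p ^ s] divides [w] exactly when this
     root lies in F(th); it does for [s = r] and does not for [s = r.+1]. *)
  have pr_dvd s : (s <= r.+1)%N -> (p ^ s %| w)%N = (m %| d 0 * e 0 * p ^ (r.+1 - s))%N.
    move=> le_sr; have ps_gt0 : (0 < p ^ s)%N by rewrite expn_gt0 prime_gt0.
    have pr_split : (p ^ r.+1 = p ^ s * p ^ (r.+1 - s))%N by rewrite -expnD subnKC.
    rewrite -(dvdn_pmul2l m_gt0) -def_E /E pr_split -mulnA (mulnC m).
    by rewrite dvdn_pmul2l // mulnC.
  apply/eqP; rewrite eqn_leq -ltnS ltnNge -!pfactor_dvdn // !pr_dvd //.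
  by rewrite subnn muln1 th_out subSnn expn1.
move/(congr1 (logn p)); rewrite !logn_prod => [|i|i]; rewrite ?gcdn_gt0 ?w_gt0 //.
under eq_bigr do rewrite logn_gcd // rw.
by under [RHS]eq_bigr do rewrite logn_gcd // rw.
Qed.

End PrimaryCounts.

(** * Commutator forms *)

Definition symmetric_cocycle (F : comUnitRingType) (gT : finGroupType)
  (alpha : gT -> gT -> F) : Prop := forall g h, alpha g h = alpha h g.

Definition cocycle_exp (F : comUnitRingType) (gT : finGroupType)
  (alpha : gT -> gT -> F) (n : nat) : gT -> gT -> F := fun g h => alpha g h ^+ n.

(** For commuting [g] and [h], [u_g u_h = comm_form alpha g h * u_h u_g] in the twisted group
    ring. *)
Definition comm_form (F : fieldType) (gT : finGroupType)
  (alpha : gT -> gT -> F) g h := alpha g h / alpha h g.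

Section CommutatorForm.

Variables (F : fieldType) (gT : finGroupType) (alpha : gT -> gT -> F).
Hypotheses (abelG : abelian [set: gT]) (alphaP : cocycle alpha).

Let alpha_neq0 g h : alpha g h != 0.
Proof. by rewrite -unitfE; case: alphaP. Qed.

Lemma comm_form_neq0 g h : comm_form alpha g h != 0.
Proof. by rewrite mulf_neq0 ?invr_eq0. Qed.

Lemma comm_formV g h : comm_form alpha h g = (comm_form alpha g h)^-1.
Proof. by rewrite /comm_form invf_div. Qed.

Lemma comm_formxx g : comm_form alpha g g = 1.
Proof. by rewrite /comm_form divff. Qed.

(** Combines the cocycle identity at the triples [(g, h, k)], [(k, g, h)] and [(g, k, h)], the three
    positions of [k]. *)
Lemma comm_formMl k g h :
  comm_form alpha (g * h)%g k = comm_form alpha g k * comm_form alpha h k.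
Proof.
have mulgC (a b : gT) : (a * b = b * a)%g by have /centsP cGG := abelG; apply: cGG; rewrite inE.
have [_ coc] := alphaP; rewrite /comm_form mulf_div; apply/eqP.
rewrite eqr_div ?mulf_neq0 //; apply/eqP; apply: (mulfI (alpha_neq0 g h)).
have e1 := coc g h k; have e2 := coc k g h; have e3 := coc g k h.
rewrite (mulgC k h) in e3; rewrite (mulgC k g) in e2.
transitivity (alpha g h * alpha (g * h)%g k * (alpha k g * alpha k h)); first by ring.
transitivity (alpha g h * alpha k (g * h)%g * (alpha g k * alpha h k)); last by ring.
rewrite -e1 e2.
transitivity (alpha h k * alpha k g * (alpha k h * alpha g (h * k)%g)); first by ring.
by rewrite e3; ring.
Qed.

Lemma comm_form1l k : comm_form alpha 1%g k = 1.
Proof.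
by apply: (mulfI (comm_form_neq0 1%g k)); rewrite -comm_formMl mulg1 mulr1.
Qed.

Lemma comm_formXl k g n : comm_form alpha (g ^+ n)%g k = comm_form alpha g k ^+ n.
Proof.
elim: n => [|n IHn]; first by rewrite expg0 comm_form1l.
by rewrite expgS comm_formMl IHn exprS.
Qed.

Lemma comm_form_gen_symmetric N d (x : 'I_N -> gT) c : coordinates d x c ->
  (forall i j : 'I_N, (i < j)%N -> comm_form alpha (x i) (x j) = 1) ->
  symmetric_cocycle alpha.
Proof.
move=> cG gen1.
have gen i j : comm_form alpha (x i) (x j) = 1.
  case: (ltngtP i j) => [|ji|/val_inj->]; [exact: gen1| |exact: comm_formxx].
  by rewrite comm_formV gen1 // invr1.
have one g h : comm_form alpha g h = 1.
  rewrite (morph_coord cG (comm_form1l h) (comm_formMl h)) big1 // => i _.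
  rewrite comm_formV (morph_coord cG (comm_form1l (x i)) (comm_formMl (x i))) big1.
    by rewrite invr1 expr1n.
  by move=> j _; rewrite gen expr1n.
by move=> g h; apply: (divIf (alpha_neq0 h g)); rewrite divff //; apply: one.
Qed.

End CommutatorForm.

(** * Cocycles with prescribed commutator forms *)

Section AlternatingCocycles.

Variables (F : fieldType) (gT : finGroupType) (N : nat) (d : nat -> nat).
Variables (x : 'I_N -> gT) (c : 'I_N -> gT -> nat).
Hypothesis cG : coordinates d x c.
Variables (n : nat) (z : F).
Hypothesis prz : n.-primitive_root z.

Implicit Type t : {ffun 'I_N * 'I_N -> 'I_n}.

(** Encodes alternating bicharacters with values in the [n]-th roots of unity by their exponents
    above the diagonal; zeros elsewhere make the code unique. Since [d j] divides [d i] for [i < j],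
    divisibility at [d j] also ensures it at [d i]. *)
Definition alt_params : pred {ffun 'I_N * 'I_N -> 'I_n} :=
  [pred t : {ffun 'I_N * 'I_N -> 'I_n} | [forall ij : 'I_N * 'I_N,
     if (ij.1 < ij.2)%N then (n %| d ij.2 * t ij)%N else val (t ij) == 0%N]].

(** Bimultiplicative, hence a cocycle. As [t] is strictly upper triangular, the commutator form at
    [x i], [x j] with [i < j] is just [z ^+ t (i, j)]. *)
Definition alt_cocycle t (g h : gT) : F :=
  \prod_ij z ^+ (t ij * (c ij.1 g * c ij.2 h)).

Let z_neq0 : z != 0.
Proof. by rewrite (prim_root_eq0 prz) -lt0n (prim_order_gt0 prz). Qed.

Lemma alt_params_exp t (ij : 'I_N * 'I_N) : t \in alt_params ->
  z ^+ (d ij.1 * t ij) = 1 /\ z ^+ (d ij.2 * t ij) = 1.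
Proof.
rewrite inE => /forallP/(_ ij); case: ifP => [lt_ij dvd_n|_ /eqP->]; last by rewrite !muln0.
have e2 : z ^+ (d ij.2 * t ij) = 1 by apply/eqP; rewrite -(prim_order_dvd prz).
split=> //; have /dvdnP[q ->] := coord_dvd cG (ltnW lt_ij).
by rewrite -mulnA mulnC exprM e2 expr1n.
Qed.

Lemma exp_modn_eq (m k s l : nat) : z ^+ (l * s) = 1 -> m = k %[mod l] ->
  z ^+ (s * m) = z ^+ (s * k).
Proof.
move=> zls mk.
have red r : z ^+ (s * r) = z ^+ (s * (r %% l)).
  rewrite {1}(divn_eq r l) mulnDr exprD (mulnC (r %/ l)%N) mulnA (mulnC s).
  by rewrite exprM zls expr1n mul1r.
by rewrite red mk -red.
Qed.

Lemma alt_cocycleMl t g g' h : t \in alt_params ->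
  alt_cocycle t (g * g')%g h = alt_cocycle t g h * alt_cocycle t g' h.
Proof.
move=> tP; rewrite -big_split; apply: eq_bigr => ij _ /=.
rewrite -exprD -mulnDr -mulnDl; apply: (exp_modn_eq (alt_params_exp ij tP).1).
by rewrite -modnMml (coord_mul cG) modnMml.
Qed.

Lemma alt_cocycleMr t g h h' : t \in alt_params ->
  alt_cocycle t g (h * h')%g = alt_cocycle t g h * alt_cocycle t g h'.
Proof.
move=> tP; rewrite -big_split; apply: eq_bigr => ij _ /=.
rewrite -exprD -!mulnDr; apply: (exp_modn_eq (alt_params_exp ij tP).2).
by rewrite -modnMmr (coord_mul cG) modnMmr.
Qed.

Lemma alt_cocycleP t : t \in alt_params -> cocycle (alt_cocycle t).
Proof.
move=> tP; split=> [g h|g h k].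
  by rewrite unitfE; apply/prodf_neq0 => ij _; rewrite expf_neq0.
by rewrite alt_cocycleMl // alt_cocycleMr //; ring.
Qed.

Lemma alt_cocycle_gen t i j : t \in alt_params ->
  alt_cocycle t (x i) (x j) = z ^+ t (i, j).
Proof.
move=> tP; rewrite /alt_cocycle (bigD1 (i, j)) //= big1 ?mulr1 => [|[i' j'] ne_ij].
  have [e1 e2] := alt_params_exp (i, j) tP.
  have e3 : z ^+ (d j * (t (i, j) * c i (x i))) = 1 by rewrite mulnA exprM e2 expr1n.
  rewrite mulnA (exp_modn_eq e3 (coord_gen cG j j)) eqxx muln1.
  by rewrite (exp_modn_eq e1 (coord_gen cG i i)) eqxx muln1.
have [e1 e2] := alt_params_exp (i', j') tP.
have [ii'|ii'] := eqVneq i' i.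
  rewrite (exp_modn_eq (k := 0) e2) ?muln0 //= -modnMmr (coord_gen cG).
  have -> : (j' == j) = false by apply: contraNF ne_ij => /eqP->; rewrite ii' eqxx.
  by rewrite /= mod0n muln0 mod0n.
rewrite (exp_modn_eq (k := 0) e1) ?muln0 //= -modnMml (coord_gen cG) (negPf ii').
by rewrite /= mod0n mul0n mod0n.
Qed.

Lemma alt_cocycle_exp t g h : alt_cocycle t g h ^+ n = 1.
Proof.
rewrite /alt_cocycle -prodrXl big1 // => ij _.
by rewrite -exprM mulnC exprM (prim_expr_order prz) expr1n.
Qed.

Lemma card_alt_params :
  #|alt_params| = (\prod_(ij : 'I_N * 'I_N) if (ij.1 < ij.2)%N then gcdn n (d ij.2) else 1)%N.
Proof.
have n_gt0 := prim_order_gt0 prz.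
pose Q (ij : 'I_N * 'I_N) := [pred a : 'I_n |
  if (ij.1 < ij.2)%N then (n %| d ij.2 * a)%N else val a == 0%N].
rewrite (eq_card (B := family Q)) => [|t].
  rewrite card_family foldrE big_map big_enum /=; apply: eq_bigr => ij _.
  case: (ij.1 < ij.2)%N; rewrite -?(card_ord_dvd_mul _ n_gt0).
    by apply: eq_card => a; rewrite !inE.
  rewrite -(card1 (Ordinal n_gt0)); apply: eq_card => a; rewrite !inE.
  by rewrite -val_eqE.
by apply/forallP/familyP.
Qed.

End AlternatingCocycles.

Section AlternatingTransfer.

Variables (F : fieldType) (gT hT : finGroupType) (N : nat) (d e : nat -> nat).
Variables (x : 'I_N -> gT) (c : 'I_N -> gT -> nat).
Variables (y : 'I_N -> hT) (k : 'I_N -> hT -> nat).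
Hypotheses (abelH : abelian [set: hT]).
Hypotheses (cG : coordinates d x c) (cH : coordinates e y k).
Variables (n : nat) (z : F).
Hypothesis prz : n.-primitive_root z.
Variable R : (gT -> gT -> F) -> (hT -> hT -> F) -> Prop.
Hypothesis R_exists : forall alpha, cocycle alpha -> exists beta, R alpha beta.
Hypothesis R_cocycle : forall alpha beta, R alpha beta -> cocycle beta.
Hypothesis R_mul : forall alpha alpha' beta beta',
  R alpha beta -> R alpha' beta' -> R (comul alpha alpha') (comul beta beta').
Hypothesis R_symmetric : forall alpha beta, R alpha beta ->
  (symmetric_cocycle alpha <-> symmetric_cocycle beta).

Let R_exp alpha beta m : R alpha beta ->
  R (cocycle_exp alpha m.+1) (cocycle_exp beta m.+1).
Proof.
have expS (T : finGroupType) (a : T -> T -> F) l :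
    cocycle_exp a l.+2 = comul a (cocycle_exp a l.+1).
  by apply/funext => g; apply/funext => h; rewrite /cocycle_exp exprS.
have exp1 (T : finGroupType) (a : T -> T -> F) : cocycle_exp a 1 = a.
  by apply/funext => g; apply/funext => h; rewrite /cocycle_exp expr1.
move=> Rab; elim: m => [|m IHm]; first by rewrite !exp1.
by rewrite !expS; apply: R_mul.
Qed.

(** [R] stands for the graph of the map on classes, so that the bound can be used in both
    directions. The code [t'] is read off the commutator form of a cocycle related to
    [alt_cocycle c z t]. *)
Lemma card_alt_params_le : (#|@alt_params N d n| <= #|@alt_params N e n|)%N.
Proof.
have n_gt0 := prim_order_gt0 prz.
have exT t : exists t' beta, t \in @alt_params N d n ->
    [/\ t' \in @alt_params N e n, R (alt_cocycle c z t) beta &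
      forall i j : 'I_N, (i < j)%N -> comm_form beta (y i) (y j) = z ^+ t' (i, j)].
  have [tP|ntP] := boolP (t \in @alt_params N d n); last by exists t, (fun _ _ => 1).
  have [beta Rtb] := R_exists (alt_cocycleP cG prz tP).
  have bP := R_cocycle Rtb.
  (* The [n]-th power of [alt_cocycle] is 1, in particular symmetric; so the [n]-th power of [beta]
     is symmetric too. *)
  have comm_n g h : comm_form beta g h ^+ n = 1.
    have := R_exp n.-1 Rtb; rewrite prednK // => /R_symmetric[sym _].
    have /sym/(_ g h) : symmetric_cocycle (cocycle_exp (alt_cocycle c z t) n).
      by move=> g' h'; rewrite /cocycle_exp !(alt_cocycle_exp _ prz).
    rewrite /cocycle_exp /comm_form expr_div_n => ->; rewrite divff // expf_neq0 //.
    by rewrite -unitfE; case: bP.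
  pose t' : {ffun 'I_N * 'I_N -> 'I_n} := [ffun ij : 'I_N * 'I_N =>
    if (ij.1 < ij.2)%N then sval (prim_rootP prz (comm_n (y ij.1) (y ij.2)))
    else Ordinal n_gt0].
  have t'E (i j : 'I_N) : (i < j)%N -> comm_form beta (y i) (y j) = z ^+ t' (i, j).
    by move=> ij; rewrite ffunE /= ij; case: prim_rootP.
  exists t', beta => _; split=> //; rewrite inE; apply/forallP => -[i j] /=.
  case: ifP => ij; last by rewrite ffunE /= ij.
  rewrite (prim_order_dvd prz) mulnC exprM -t'E //.
  rewrite comm_formV exprVn -(comm_formXl abelH bP) (coord_expg cH).
  by rewrite (comm_form1l abelH bP) invr1.
have [T TP] := choice exT; have {TP} [B TB] := choice TP.
rewrite -(card_in_image (f := T)); last first.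
  move=> t1 t2 t1P t2P eqT.
  have [_ R1 c1] := TB t1 t1P; have [_ R2 c2] := TB t2 t2P.
  (* The exponent [2 * n - 1] acts as an inverse on [n]-th roots of unity and stays positive even
     for [n = 1]. Equal codes make the quotient of the two [beta] symmetric, hence that of the two
     [alt_cocycle], which forces [t1 = t2]. *)
  have := R_mul R1 (R_exp (n + n).-2 R2); set alpha := comul _ _; set beta := comul _ _ => Rab.
  have twon : ((n + n).-2.+2 = n + n)%N by case: (n) n_gt0 => // m _; rewrite addnS.
  have symb : symmetric_cocycle beta.
    apply: (comm_form_gen_symmetric abelH (R_cocycle Rab) cH) => i j ij.
    have -> : comm_form beta (y i) (y j) =
        comm_form (B t1) (y i) (y j) * comm_form (B t2) (y i) (y j) ^+ (n + n).-2.+1.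
      by rewrite /comm_form /beta /comul /cocycle_exp expr_div_n mulf_div.
    rewrite c1 // c2 // -eqT -exprS twon -exprM mulnC exprM exprD.
    by rewrite (prim_expr_order prz) mulr1 expr1n.
  have /(R_symmetric Rab) syma := symb.
  apply/ffunP => -[i j]; apply: val_inj => /=.
  have [ij|ji] := ltnP i j; last first.
    have := t1P; rewrite inE => /forallP/(_ (i, j)) /=; rewrite ltnNge ji /= => /eqP ->.
    by have := t2P; rewrite inE => /forallP/(_ (i, j)) /=; rewrite ltnNge ji /= => /eqP ->.
  have zero t : t \in @alt_params N d n -> t (j, i) = 0%N :> nat.
    by rewrite inE => /forallP/(_ (j, i)) /=; rewrite ltnNge (ltnW ij) /= => /eqP ->.
  have := syma (x i) (x j); rewrite /alpha /comul /cocycle_exp.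
  rewrite !(alt_cocycle_gen cG prz) // !zero // expr0 expr1n mulr1.
  move/(congr1 (fun u => u * z ^+ t2 (i, j))).
  rewrite -mulrA -exprSr twon -exprM mulnC exprM exprD (prim_expr_order prz) mulr1.
  rewrite expr1n mulr1 mul1r => /eqP.
  by rewrite (eq_prim_root_expr prz) !modn_small // => /eqP.
apply/subset_leq_card/subsetP => _ /imageP[t tP ->].
by have [] := TB t tP.
Qed.

End AlternatingTransfer.

Lemma logn_card_alt_params (F : fieldType) N d p t (z : F) : prime p ->
  (forall i, 0 < d i)%N -> (p ^ t).-primitive_root z ->
  (logn p #|@alt_params N d (p ^ t)| =
   \sum_(j < N) j * minn t (logn p (d j)))%N.
Proof.
move=> p_pr d_gt0 prz; have pt_gt0 := prim_order_gt0 prz.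
rewrite (card_alt_params _ _ prz) logn_prod => [|ij]; last first.
  by case: ifP => // _; rewrite gcdn_gt0 pt_gt0.
transitivity (\sum_(i < N) \sum_(j < N) (i < j) * minn t (logn p (d j)))%N.
  rewrite pair_big /=; apply: eq_bigr => ij _; case: ifP => _; rewrite ?logn1 //.
  by rewrite mul1n logn_gcd // pfactorK.
(* The weight is the number of [i < j]. *)
rewrite exchange_big /=; apply: eq_bigr => j _; rewrite -big_distrl /=; congr (_ * _)%N.
rewrite -[RHS]card_ord -sum1_card (big_ord_widen N (fun=> 1%N) (ltnW (ltn_ord j))).
by rewrite [RHS]big_mkcond; apply: eq_bigr => i _; case: (i < j)%N.
Qed.

(** * Cohomologous cocycles and commutativity of twisted group rings *)

Section TwistedRings.

Variables (F : fieldType) (gT : finGroupType).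
Implicit Types alpha beta : gT -> gT -> F.

Lemma cohom_trans alpha beta gamma :
  cohom alpha beta -> cohom beta gamma -> cohom alpha gamma.
Proof.
move=> [a [aU ab]] [b [bU bc]]; exists (fun g => a g * b g).
split=> [g|g h]; first by rewrite unitrM aU bU.
by rewrite bc ab invfM; ring.
Qed.

Lemma cohom_refl alpha : cohom alpha alpha.
Proof.
by exists (fun=> 1); split=> [g|g h]; rewrite ?unitr1 // !mul1r invr1 mulr1.
Qed.

Lemma cohom_comul alpha alpha' beta beta' :
  cohom alpha beta -> cohom alpha' beta' -> cohom (comul alpha alpha') (comul beta beta').
Proof.
move=> [a [aU ab]] [b [bU bc]]; exists (fun g => a g * b g).
split=> [g|g h]; first by rewrite unitrM aU bU.
by rewrite /comul bc ab invfM; ring.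
Qed.

Lemma cocycle_comul alpha beta :
  cocycle alpha -> cocycle beta -> cocycle (comul alpha beta).
Proof.
move=> [aU aC] [bU bC]; split=> [g h|g h k]; first by rewrite unitrM aU bU.
by rewrite /comul mulrACA aC bC mulrACA.
Qed.

Lemma trivial_cocycleP : cocycle (@trivial_cocycle F gT).
Proof. by split=> *; rewrite ?unitr1. Qed.

Lemma cohom_symmetric alpha beta : abelian [set: gT] -> cohom alpha beta ->
  symmetric_cocycle alpha <-> symmetric_cocycle beta.
Proof.
move=> /centsP abelG [b [bU ab]].
have mulgC (g h : gT) : (g * h = h * g)%g by apply: abelG; rewrite inE.
have u_neq0 g h : b g * b h / b (g * h)%g != 0 by rewrite -unitfE unitrM unitrV unitrM !bU.
split=> sym g h; first by rewrite !ab sym (mulgC h g) (mulrC (b h)).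
apply: (mulIf (u_neq0 g h)); rewrite -ab sym ab (mulgC h g).
by rewrite (mulrC (b h)).
Qed.

(** Rescale the basis: [u_g] goes to [b g * u_g]. *)
Lemma cohom_twisted_ring_iso alpha beta : cocycle alpha -> cocycle beta ->
  cohom alpha beta -> twisted_ring_iso beta alpha.
Proof.
move=> [aU _] [bU _] [b [b_unit ab]]; have b_neq0 g : b g != 0 by rewrite -unitfE.
exists (fun u : {ffun gT -> F} => [ffun g => b g * u g]); split.
  exists (fun u : {ffun gT -> F} => [ffun g => (b g)^-1 * u g]) => u;
    apply/ffunP => g; rewrite !ffunE.
    by rewrite mulKf.
  by rewrite mulVKf.
split=> [u v|]; first by apply/ffunP => g; rewrite !ffunE mulrDr.
split=> [u v|].
  apply/ffunP => y; rewrite !ffunE mulr_sumr; apply: eq_bigr => g _.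
  rewrite mulr_sumr; apply: eq_bigr => h /eqP <-; rewrite !ffunE ab.
  rewrite -[RHS](mulfK (b_neq0 (g * h)%g)); ring.
apply/ffunP => g; rewrite !ffunE; case: eqP => [->|_]; last by rewrite mulr0.
by rewrite ab mulg1 mulfK // invfM mulrCA mulfV ?mulr1.
Qed.

Lemma tmul_symmetric alpha : abelian [set: gT] ->
  symmetric_cocycle alpha <-> (forall u v, tmul alpha u v = tmul alpha v u).
Proof.
move=> /centsP abelG.
have mulgC (g h : gT) : (g * h = h * g)%g by apply: abelG; rewrite inE.
split=> [sym u v|comm g h].
  apply/ffunP => y; rewrite !ffunE (exchange_big_dep predT) //=; apply: eq_bigr => h _.
  apply: eq_big => [g|g _]; first by rewrite mulgC.
  by rewrite sym (mulrC (u g)).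
have tmul_elt a b y : tmul alpha (galg_elt F a) (galg_elt F b) y =
    if y == (a * b)%g then alpha a b else 0.
  rewrite ffunE (bigD1 a) //= [X in _ + X]big1 ?addr0 => [|a' /negPf a'a]; last first.
    by apply: big1 => b' _; rewrite !ffunE a'a !mul0r.
  rewrite big_mkcond (bigD1 b) //= big1 ?addr0 => [|b' /negPf b'b]; last first.
    by rewrite !ffunE b'b mulr0 mul0r if_same.
  by rewrite !ffunE !eqxx !mul1r eq_sym.
have := congr1 (fun u : {ffun gT -> F} => u (g * h)%g) (comm (galg_elt F g) (galg_elt F h)).
by rewrite /= !tmul_elt eqxx (mulgC h g) eqxx.
Qed.

End TwistedRings.

Lemma twisted_ring_iso_symmetric (F : fieldType) (gT hT : finGroupType)
    (alpha : gT -> gT -> F) (beta : hT -> hT -> F) :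
  abelian [set: gT] -> abelian [set: hT] -> twisted_ring_iso alpha beta ->
  symmetric_cocycle alpha <-> symmetric_cocycle beta.
Proof.
move=> abelG abelH [phi [[psi phiK psiK] [_ [phiM _]]]].
rewrite !tmul_symmetric //; split=> comm u v.
  by rewrite -(psiK u) -(psiK v) -!phiM comm.
by apply: (can_inj phiK); rewrite !phiM comm.
Qed.

(** * Consequences of the isomorphism of cohomology groups *)

Section SimRing.

Variables (F : fieldType) (gT hT : finGroupType).
Hypotheses (abelG : abelian [set: gT]) (abelH : abelian [set: hT]).
Variable psi : (gT -> gT -> F) -> (hT -> hT -> F).
Hypothesis psi_cocycle : forall alpha, cocycle alpha -> cocycle (psi alpha).
Hypothesis psi_mul : forall alpha alpha', cocycle alpha -> cocycle alpha' ->
  cohom (psi (comul alpha alpha')) (comul (psi alpha) (psi alpha')).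
Hypothesis psi_surj : forall beta, cocycle beta ->
  exists2 alpha, cocycle alpha & cohom (psi alpha) beta.
Hypothesis psi_iso : forall alpha, cocycle alpha -> twisted_ring_iso alpha (psi alpha).

(** The graph of [psi] on classes. Unlike [psi] itself it respects products of cocycles on the nose,
    and it can be read from either side. *)
Definition psi_related alpha beta :=
  [/\ cocycle alpha, cocycle beta & cohom (psi alpha) beta].

Lemma psi_related_mul alpha alpha' beta beta' :
  psi_related alpha beta -> psi_related alpha' beta' ->
  psi_related (comul alpha alpha') (comul beta beta').
Proof.
move=> [aP bP ab] [a'P b'P ab']; split; [exact: cocycle_comul..|].
exact: cohom_trans (psi_mul aP a'P) (cohom_comul ab ab').
Qed.

Lemma psi_related_symmetric alpha beta : psi_related alpha beta ->
  symmetric_cocycle alpha <-> symmetric_cocycle beta.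
Proof.
move=> [aP bP ab]; apply: iff_trans (cohom_symmetric abelH ab).
exact: twisted_ring_iso_symmetric (psi_iso aP).
Qed.

(** The image of the trivial cocycle is cohomologous to its own square, hence a coboundary;
    rescaling then makes it trivial. *)
Lemma trivial_twisted_ring_iso :
  twisted_ring_iso (@trivial_cocycle F gT) (@trivial_cocycle F hT).
Proof.
have oneP := trivial_cocycleP F gT.
have comul1 : comul (@trivial_cocycle F gT) trivial_cocycle = trivial_cocycle.
  by apply/funext => g; apply/funext => h; rewrite /comul mulr1.
have [b [bU b1]] := psi_mul oneP oneP; rewrite comul1 in b1.
have [p1U _] := psi_cocycle oneP.
have : cohom trivial_cocycle (psi trivial_cocycle).
  exists b; split=> // g h; have p_neq0 : psi trivial_cocycle g h != 0 by rewrite -unitfE.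
  by apply: (mulfI p_neq0); rewrite mul1r -b1.
move/(cohom_twisted_ring_iso (trivial_cocycleP F hT) (psi_cocycle oneP)).
have [p [p_bij [pD [pM p1]]]] := psi_iso oneP.
move=> [q [q_bij [qD [qM q1]]]]; exists (q \o p); split; first exact: bij_comp.
by split=> [u v|] /=; rewrite ?pD ?qD //; split=> [u v|] /=; rewrite ?pM ?qM ?p1.
Qed.

Lemma card_alt_params_eq (N n : nat) (d e : nat -> nat) (x : 'I_N -> gT) c
    (y : 'I_N -> hT) k (z : F) :
  coordinates d x c -> coordinates e y k -> n.-primitive_root z ->
  #|@alt_params N d n| = #|@alt_params N e n|.
Proof.
move=> cG cH prz; apply/eqP; rewrite eqn_leq; apply/andP; split.
  apply: (card_alt_params_le abelH cG cH prz (R := psi_related)).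
  - by move=> alpha aP; exists (psi alpha); split; [|exact: psi_cocycle|exact: cohom_refl].
  - by move=> alpha beta [].
  - exact: psi_related_mul.
  - exact: psi_related_symmetric.
apply: (card_alt_params_le abelG cH cG prz (R := fun beta alpha => psi_related alpha beta)).
- by move=> beta bP; have [alpha aP ab] := psi_surj bP; exists alpha.
- by move=> beta alpha [].
- by move=> beta beta' alpha alpha'; apply: psi_related_mul.
by move=> beta alpha /psi_related_symmetric; apply: iff_sym.
Qed.

End SimRing.

(** * Comparison of the elementary divisors, prime by prime *)

Theorem theorem2 (gT hT : finGroupType) (F : fieldType)
  (L : closedFieldType) (f : {rmorphism F -> L}) :
  abelian [set: gT] -> abelian [set: hT] ->
  [pchar F] =i pred0 ->
  (forall p : nat, prime p -> odd p -> (p %| exponent [set: gT])%N ->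
     (exists z : F, p.-primitive_root z) \/
     (forall z w : L, (p ^ 2)%N.-primitive_root z -> p.-primitive_root w ->
        forall x : F, in_Qadj z (f x) -> in_Qadj w (f x))) ->
  ((2 %| exponent [set: gT])%N ->
     (exists z : F, 4.-primitive_root z) \/
     (forall z : L, 8.-primitive_root z ->
        forall x : F, in_Qadj z (f x) -> exists r : rat, f x = ratr r)) ->
  sim_ring F gT hT ->
  [set: gT] \isog [set: hT].
Proof.
move=> abelG abelH charF hyp_odd hyp_even.
move=> [psi [psi_coc [_ psi_mul _ psi_surj psi_iso]]].
have charL : [pchar L] =i pred0 by move=> x; rewrite (fmorph_pchar f) charF.
have iso := trivial_twisted_ring_iso psi_coc psi_mul psi_iso.
have [MG exG] := exists_coordinates abelG; have [MH exH] := exists_coordinates abelH.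
have [d [x [c cG]]] := exG _ (leq_maxl MG MH).
have [e [y [k cH]]] := exH _ (leq_maxr MG MH).
move: (maxn MG MH) x c cG y k cH => N x c cG y k cH {exG exH}.
have [d_gt0 e_gt0] := (coord_gt0 cG, coord_gt0 cH).
apply: (isog_coordinates abelH cG cH) => i lt_iN.
apply: eqn_from_log => // p.
have [p_pr|p_npr] := boolP (prime p); last by rewrite lognE [in RHS]lognE (negPf p_npr).
have sum_logn : (\sum_(j < N) logn p (d j) = \sum_(j < N) logn p (e j))%N.
  by rewrite -!logn_prod // (prod_orders_eq f charL cG cH iso).
(* At a prime outside the exponent of [gT] all [d j] have valuation 0, and equality of the group
   orders gives the same for the [e j]. *)
have [p_exp|p_nexp] := boolP (p %| exponent [set: gT])%N; last first.
  have d0 (j : 'I_N) : logn p (d j) = 0%N.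
    apply/eqP; rewrite -leqn0 leqNgt logn_gt0 mem_primes d_gt0 p_pr /=.
    apply: contra p_nexp => p_dj; apply: dvdn_trans (dvdn_exponent (in_setT (x j))).
    exact: dvdn_trans p_dj (coord_dvd_order cG j).
  rewrite (d0 (Ordinal lt_iN)); move/eqP: sum_logn; rewrite big1 => [|j _]; last exact: d0.
  by rewrite eq_sym sum_nat_eq0 => /forallP/(_ (Ordinal lt_iN)) /eqP.
pose B := (logn p (d 0) + logn p (e 0))%N.
have [|p2|l [z prz] levelP] := cyclotomic_level (f := f) B.+1 charF p_pr.
- by move=> p_odd; apply: hyp_odd.
- by apply: hyp_even; rewrite -p2.
have mono (a : nat -> nat) : (forall j, 0 < a j)%N ->
    (forall j j', j <= j' -> a j' %| a j)%N ->
    {homo (fun j => logn p (a j)) : j j' / (j <= j')%N >-> (j' <= j)%N}.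
  by move=> a_gt0 a_dvd j j' jj' /=; rewrite dvdn_leq_log // a_dvd.
apply: (eq_from_sums (N := N) (k := l) (mono d d_gt0 (coord_dvd cG))
  (mono e e_gt0 (coord_dvd cH))) lt_iN => [m le_lm|t le_tl].
  have [->|m_gt0] := posnP m; first by rewrite !big1 // => j _; rewrite min0n.
  (* [B] bounds every valuation involved, so beyond it nothing is truncated and the sums are those
     of [sum_logn]. *)
  have [le_mB|lt_Bm] := leqP m B.
    apply: (sum_minn_logn_eq (f := f) charL cG cH iso p_pr) => Z prZ.
    by apply: levelP (prZ) => //; apply/andP; split.
  have bound a b : (a <= b -> b <= B -> minn m a = a)%N.
    by move=> ab bB; apply/minn_idPr; rewrite (leq_trans ab) // (leq_trans bB) // ltnW.
  rewrite (eq_bigr (fun j : 'I_N => logn p (d j))) => [|j _]; last first.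
    by apply: (bound _ (logn p (d 0))); rewrite ?leq_addr // (mono d d_gt0 (coord_dvd cG)).
  rewrite [RHS](eq_bigr (fun j : 'I_N => logn p (e j))) // => j _.
  by apply: (bound _ (logn p (e 0))); rewrite ?leq_addl // (mono e e_gt0 (coord_dvd cH)).
have prt : (p ^ t).-primitive_root (z ^+ (p ^ (l - t))).
  by apply: prim_root_pow; rewrite // subnKC.
rewrite -(logn_card_alt_params N p_pr d_gt0 prt) -(logn_card_alt_params N p_pr e_gt0 prt).
by rewrite (card_alt_params_eq abelG abelH psi_coc psi_mul psi_surj psi_iso cG cH prt).
Qed.
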